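(* Let $k$ be a field and let $H$ be a finite-dimensional dual quasitriangular Hopf algebra over $k$ with universal $r$-form $r$. Let $\sigma$ be a left $2$-cocycle for $H$. Let $A_\sigma$ be the right $H^{op}$-comodule algebra which equals $H$ as a vector space, with coaction $\Delta$ and with product $h\cdot k'=\sum\sigma(k'_{(1)}\otimes h_{(1)})\,k'_{(2)}h_{(2)}$ for $h,k'\in H$. Let $\theta_\sigma\colon H\to H^*$ be the linear map $\theta_\sigma(h)=r_\sigma(-\otimes h)$, where $r_\sigma=(\sigma\tau)*r*\sigma^{-1}$. Then $A_\sigma$ is $(H,r)$-Azumaya if and only if $\theta_\sigma$ is invertible.
   Context: Sweedler notation $\Delta(h)=\sum h_{(1)}\otimes h_{(2)}$ for coproducts and $\rho(m)=\sum m_{(0)}\otimes m_{(1)}$ for right coactions is used; $\tau$ is the flip, so $(\sigma\tau)(h\otimes l)=\sigma(l\otimes h)$; $*$ is the convolution product in $(H\otimes H)^*$ and $\sigma^{-1}$ is the convolution inverse. Universal $r$-form: a convolution invertible $r\in(H\otimes H)^*$ with $r(ab\otimes c)=\sum r(a\otimes c_{(1)})r(b\otimes c_{(2)})$, $r(a\otimes bc)=\sum r(a_{(1)}\otimes c)r(a_{(2)}\otimes b)$ and $\sum b_{(1)}a_{(1)}r(a_{(2)}\otimes b_{(2)})=\sum r(a_{(1)}\otimes b_{(1)})a_{(2)}b_{(2)}$ for all $a,b,c\in H$. A Hopf algebra with a universal $r$-form is called dual quasitriangular. (Left) $2$-cocycle for $H$: a convolution invertible $\sigma\in(H\otimes H)^*$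 with $\sigma(h\otimes 1)=\sigma(1\otimes h)=\varepsilon(h)$ and $\sum\sigma(l_{(1)}\otimes m_{(1)})\sigma(h\otimes l_{(2)}m_{(2)})=\sum\sigma(h_{(1)}\otimes l_{(1)})\sigma(h_{(2)}l_{(2)}\otimes m)$ for all $h,l,m\in H$. $(H,r)$-Azumaya: let $A$ be a finite-dimensional right $H^{op}$-comodule algebra, i.e. a right $H$-comodule and an algebra with $\rho(1)=1\otimes1$ and $\rho(ab)=\sum a_{(0)}b_{(0)}\otimes b_{(1)}a_{(1)}$. Its opposite $\overline A$ is $A$ as a comodule, with product $a\circ b=\sum b_{(0)}a_{(0)}\,r(b_{(1)}\otimes a_{(1)})$. For two such algebras $A,B$, $A\#B$ is $A\otimes B$ with product $(a\#b)(c\#d)=\sum (a c_{(0)}\#b_{(0)}d)\,r(c_{(1)}\otimes b_{(1)})$. $A$ is $(H,r)$-Azumaya if the $H^{op}$-comodule algebra maps $F\colon A\#\overline A\to End(A)$, $F(a\#\bar b)(c)=\sum a\,c_{(0)}b_{(0)}\,r(c_{(1)}\otimes b_{(1)})$, and $G\colon\overline A\#A\to End(A)^{op}$, $G(\bar a\#b)(c)=\sum r(a_{(1)}\otimes c_{(1)})\,a_{(0)}c_{(0)}b$, are both isomorphisms (equivalently, bijective). *)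

(* Defs.v *)
From HB Require Import structures.
From mathcomp Require Import all_boot all_order all_algebra all_field.

Set Implicit Arguments.
Unset Strict Implicit.
Unset Printing Implicit Defensive.

Import GRing.Theory VectorInternalTheory.
Local Open Scope ring_scope.

Reserved Notation "u ⊗ v" (at level 35, no associativity).
Reserved Notation "\sw_ ( x , y <- t ) E"
  (at level 36, x name, y name, t at level 200, E at level 36,
   format "'[' \sw_ ( x ,  y  <-  t ) '/  '  E ']'").

(* The tensor product of two finite-dimensional spaces, in coordinates:
   the (i, j) entry of a tensor is its coefficient on r2v 'e_i ⊗ r2v 'e_j.
   The universal property is [tliftE] together with [tensor_ext]. *)
Section Tensor.
Variable k : fieldType.

Definition tensor (U V : vectType k) : Type := 'M[k]_(dim U, dim V).

Definition dual (V : vectType k) := 'Hom(V, k^o).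

Definition pure (U V : vectType k) (u : U) (v : V) : tensor U V :=
  (v2r u)^T *m v2r v.

(* For a bilinear f, the linear extension of u ⊗ v |-> f u v.  For a coproduct
   or a coaction t, this is the Sweedler sum of the f t_(1) t_(2). *)
Definition tlift (U V W : vectType k) (f : U -> V -> W) (t : tensor U V) : W :=
  \sum_(i < dim U) \sum_(j < dim V)
    (t : 'M_(_, _)) i j *: f (r2v (delta_mx 0 i)) (r2v (delta_mx 0 j)).

Definition is_bilinear (U V W : vectType k) (f : U -> V -> W) : Prop :=
  (forall u, linear (f u)) /\ (forall v, linear (f^~ v)).

End Tensor.

Notation "u ⊗ v" := (pure u v) : ring_scope.
Notation "\sw_ ( x , y <- t ) E" := (tlift (fun x y => E) t) : ring_scope.

Section TensorTheory.
Variable k : fieldType.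
Implicit Types U V W : vectType k.

Lemma tlift_is_linear U V W (f : U -> V -> W) : linear (tlift f).
Proof.
move=> a s t; rewrite /tlift scaler_sumr -big_split; apply: eq_bigr => i _ /=.
rewrite scaler_sumr -big_split; apply: eq_bigr => j _ /=.
by rewrite !mxE scalerDl scalerA.
Qed.

Lemma pure_bilinear U V : is_bilinear (@pure k U V).
Proof.
split=> [u|v] a x y; first by rewrite /pure linearP /= linearP.
by rewrite /pure !linearP /= mulmxDl scalemxAl.
Qed.

Lemma tliftE U V W (f : U -> V -> W) u v :
  is_bilinear f -> tlift f (u ⊗ v) = f u v.
Proof.
case=> fr fl.
have sum_r n (x : U) (c : 'I_n -> k) (y : 'I_n -> V) :
  f x (\sum_i c i *: y i) = \sum_i c i *: f x (y i).
  pose F := GRing.isLinear.Build k V W *:%R (f x) (fr x).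
  pose L : {linear V -> W} := HB.pack (f x) F.
  rewrite -[f x]/(L : V -> W) linear_sum.
  by apply: eq_bigr => i _; rewrite linearZ.
have sum_l n (y : V) (c : 'I_n -> k) (x : 'I_n -> U) :
  f (\sum_i c i *: x i) y = \sum_i c i *: f (x i) y.
  pose F := GRing.isLinear.Build k U W *:%R (f^~ y) (fl y).
  pose L : {linear U -> W} := HB.pack (f^~ y) F.
  rewrite -[f _ y]/(L _) linear_sum.
  by apply: eq_bigr => i _; rewrite linearZ.
have dec (X : vectType k) (x : X) :
  x = \sum_i v2r x 0 i *: r2v (delta_mx 0 i).
  rewrite -{1}[x]v2rK {1}[v2r x]row_sum_delta linear_sum.
  by apply: eq_bigr => i _; rewrite linearZ.
rewrite {2}[u]dec sum_l /tlift; apply: eq_bigr => i _.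
rewrite {2}[v]dec sum_r scaler_sumr; apply: eq_bigr => j _.
by rewrite scalerA /pure !mxE big_ord1 mxE.
Qed.

Lemma tensor_ext U V W (f g : tensor U V -> W) : linear f -> linear g ->
  (forall u v, f (u ⊗ v) = g (u ⊗ v)) -> f =1 g.
Proof.
move=> fL gL fg t.
pose Ff := GRing.isLinear.Build k (tensor U V) W *:%R f fL.
pose f' : {linear tensor U V -> W} := HB.pack f Ff.
pose Fg := GRing.isLinear.Build k (tensor U V) W *:%R g gL.
pose g' : {linear tensor U V -> W} := HB.pack g Fg.
have -> : t = \sum_i \sum_j (t : 'M_(_, _)) i j *:
    (r2v (delta_mx 0 i) ⊗ r2v (delta_mx 0 j) : tensor U V).
  rewrite {1}[t](matrix_sum_delta t); apply: eq_bigr => i _.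
  apply: eq_bigr => j _; congr (_ *: _).
  by rewrite /pure !r2vK trmx_delta mul_delta_mx.
rewrite -[f]/(f' : _ -> _) -[g]/(g' : _ -> _) !linear_sum.
apply: eq_bigr => i _; rewrite !linear_sum; apply: eq_bigr => j _.
by rewrite !linearZ /= fg.
Qed.

End TensorTheory.

HB.mixin Record Falgebra_isHopf (k : fieldType) H of Falgebra k H := {
  Delta : 'Hom(H, tensor H H);
  eps : dual H;
  antipode : 'End(H);
  coassoc_subproof : forall h : H,
    \sw_(h1, h2 <- Delta h) \sw_(h11, h12 <- Delta h1) (h11 ⊗ (h12 ⊗ h2)) =
    \sw_(h1, h2 <- Delta h) \sw_(h21, h22 <- Delta h2) (h1 ⊗ (h21 ⊗ h22));
  counitl_subproof : forall h : H, \sw_(h1, h2 <- Delta h) (eps h1 *: h2) = h;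
  counitr_subproof : forall h : H, \sw_(h1, h2 <- Delta h) (eps h2 *: h1) = h;
  Delta1_subproof : Delta (1 : H) = (1 : H) ⊗ (1 : H);
  DeltaM_subproof : forall a b : H,
    Delta (a * b) = \sw_(a1, a2 <- Delta a) \sw_(b1, b2 <- Delta b)
                      ((a1 * b1) ⊗ (a2 * b2));
  eps1_subproof : eps (1 : H) = 1;
  epsM_subproof : forall a b : H, eps (a * b) = eps a * eps b;
  antipodel_subproof : forall h : H,
    \sw_(h1, h2 <- Delta h) (antipode h1 * h2) = (eps h)%:A;
  antipoder_subproof : forall h : H,
    \sw_(h1, h2 <- Delta h) (h1 * antipode h2) = (eps h)%:A
}.

#[short(type="hopfType")]
HB.structure Definition Hopf (k : fieldType) :=
  { H of Falgebra_isHopf k H & Falgebra k H }.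

Section Cocycles.
Variables (k : fieldType) (H : hopfType k).
Implicit Types f g r sigma : dual (tensor H H).

Definition conv f g : dual (tensor H H) :=
  linfun (fun t => \sw_(h, l <- t)
    \sw_(h1, h2 <- Delta h) \sw_(l1, l2 <- Delta l)
      (f (h1 ⊗ l1) * g (h2 ⊗ l2) : k^o)).

Definition conv1 : dual (tensor H H) :=
  linfun (fun t => \sw_(h, l <- t) (eps h * eps l : k^o)).

Definition conv_inverse f g : Prop := conv f g = conv1 /\ conv g f = conv1.

Definition conv_invertible f : Prop := exists g, conv_inverse f g.

Definition universal_rform r : Prop :=
  [/\ conv_invertible r,
      forall a b c : H,
        r ((a * b) ⊗ c) =
        \sw_(c1, c2 <- Delta c) (r (a ⊗ c1) * r (b ⊗ c2) : k^o),
      forall a b c : H,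
        r (a ⊗ (b * c)) =
        \sw_(a1, a2 <- Delta a) (r (a1 ⊗ c) * r (a2 ⊗ b) : k^o)
    & forall a b : H,
        \sw_(a1, a2 <- Delta a) \sw_(b1, b2 <- Delta b)
          (r (a2 ⊗ b2) *: (b1 * a1)) =
        \sw_(a1, a2 <- Delta a) \sw_(b1, b2 <- Delta b)
          (r (a1 ⊗ b1) *: (a2 * b2))].

Definition two_cocycle sigma : Prop :=
  [/\ conv_invertible sigma,
      forall h : H, sigma (h ⊗ 1) = eps h,
      forall h : H, sigma (1 ⊗ h) = eps h
    & forall h l m : H,
        \sw_(l1, l2 <- Delta l) \sw_(m1, m2 <- Delta m)
          (sigma (l1 ⊗ m1) * sigma (h ⊗ (l2 * m2)) : k^o) =
        \sw_(h1, h2 <- Delta h) \sw_(l1, l2 <- Delta l)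
          (sigma (h1 ⊗ l1) * sigma ((h2 * l2) ⊗ m) : k^o)].

Definition flip (U V : vectType k) : 'Hom(tensor U V, tensor V U) :=
  linfun (fun t => \sw_(u, v <- t) (v ⊗ u)).

(* r_sigma; sigmainv is meant to be the convolution inverse of sigma. *)
Definition twisted_rform r sigma sigmainv : dual (tensor H H) :=
  conv (conv (sigma \o flip H H)%VF r) sigmainv.

Definition theta r sigma sigmainv : 'Hom(H, dual H) :=
  linfun (fun h => linfun (fun x : H =>
    twisted_rform r sigma sigmainv (x ⊗ h)) : dual H).

End Cocycles.

(* The data of a finite-dimensional algebra with a right H-coaction; the
   axioms are in [opcomodule_algebra]. *)
Record comodAlgData (k : fieldType) (H : hopfType k) := ComodAlgData {
  carrier :> vectType k;
  cmul : carrier -> carrier -> carrier;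
  cone : carrier;
  coact : 'Hom(carrier, tensor carrier H)
}.

Section Azumaya.
Variables (k : fieldType) (H : hopfType k).
Implicit Types (r : dual (tensor H H)) (A : comodAlgData H).

Local Notation "a ⋅ b" := (cmul a b) (at level 40, left associativity).

Definition opcomodule_algebra A : Prop :=
  [/\ [/\ is_bilinear (@cmul k H A),
          associative (@cmul k H A),
          left_id (cone A) (@cmul k H A)
        & right_id (cone A) (@cmul k H A)],
      (forall a : A,
        \sw_(a0, a1 <- coact A a) \sw_(a00, a01 <- coact A a0)
          (a00 ⊗ (a01 ⊗ a1)) =
        \sw_(a0, a1 <- coact A a) \sw_(a11, a12 <- Delta a1)
          (a0 ⊗ (a11 ⊗ a12))) /\
      (forall a : A, \sw_(a0, a1 <- coact A a) (eps (a1 : H) *: a0) = a),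
      coact A (cone A) = cone A ⊗ (1 : H)
    & forall a b : A,
        coact A (a ⋅ b) =
        \sw_(a0, a1 <- coact A a) \sw_(b0, b1 <- coact A b)
          ((a0 ⋅ b0) ⊗ (b1 * a1))].

(* The underlying space of both A # Abar and Abar # A is tensor A A, and that
   of both End(A) and its opposite is 'End(A). *)
Definition azumayaF r A : 'Hom(tensor A A, 'End(A)) :=
  linfun (fun t => \sw_(a, b <- t) linfun (fun c : A =>
    \sw_(c0, c1 <- coact A c) \sw_(b0, b1 <- coact A b)
      (r (c1 ⊗ b1) *: (a ⋅ c0 ⋅ b0)))).

Definition azumayaG r A : 'Hom(tensor A A, 'End(A)) :=
  linfun (fun t => \sw_(a, b <- t) linfun (fun c : A =>
    \sw_(a0, a1 <- coact A a) \sw_(c0, c1 <- coact A c)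
      (r (a1 ⊗ c1) *: (a0 ⋅ c0 ⋅ b)))).

(* F and G are automatically morphisms of H^op-comodule algebras, so that they
   are isomorphisms exactly when they are bijective. *)
Definition azumaya r A : Prop :=
  [/\ opcomodule_algebra A, bijective (azumayaF r A)
    & bijective (azumayaG r A)].

Definition twisted_alg (sigma : dual (tensor H H)) : comodAlgData H :=
  @ComodAlgData k H H
    (fun h l => \sw_(h1, h2 <- Delta h) \sw_(l1, l2 <- Delta l)
      (sigma (l1 ⊗ h1) *: (l2 * h2)))
    1 Delta.

End Azumaya.

(* Main.v *)
From HB Require Import structures.
Require Import Defs.
From mathcomp Require Import all_boot all_order all_algebra all_field.

Set Implicit Arguments.
Unset Strict Implicit.
Unset Printing Implicit Defensive.

Import GRing.Theory VectorInternalTheory.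
Local Open Scope ring_scope.

(** Write [x . y] for the product of the algebra [twisted_alg sigma].  The
    commutation axiom of the universal r-form [r], moved past [sigma], becomes
    [r(x2, y2) x1 . y1 = r_sigma(x1, y1) y2 . x2] ([twisted_mul_rform]).
    With associativity it turns the map [F] into
    [F(a # b)(c) = r_sigma(c1, b1) (a . b2) . c2], which is a composite of
    three linear maps:

    - [a ⊗ b |-> a . b2 ⊗ b1], on [H ⊗ H];
    - [a ⊗ b |-> (c |-> r_sigma(c, b) a)], from [H ⊗ H] to [End(H)];
    - [f |-> (c |-> f(c1) . c2)], on [End(H)].

    The first and the last one are bijective because the algebra is cleft: the
    identity of [H] has a one-sided inverse for each of the two convolution
    products, [J(c2) . c1 = eps(c)] and [c1 . J'(c2) = eps(c)], and in finite
    dimension one-sided inverses suffice.  The middle map is bijective exactly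
    when [r_sigma(-, b) = 0] forces [b = 0], that is, when [theta] is
    injective ([sandwich_bijP]).  The map [G] has the same shape for the
    opposite product and for [r_sigma] with its arguments exchanged
    ([azumayaG_pure]); nondegeneracy of [r_sigma] in its other argument follows
    from the surjectivity of [theta].

    One inverse is [J(c) = sigma^-1(S c2, c3) S c1] ([cleft_inverseP]).  The
    other one is the same formula for the opposite Hopf algebra, whose antipode
    is [S^-1] and for which [sigma tau] is a cocycle.  It requires a bijective
    antipode, which the r-form provides ([antipode_surj]): the functional
    [f(c) = r(c1, S c2)] satisfies [c1 f(c2) = f(c1) S(S c2)] and has a
    convolution right inverse.

    Identities between Sweedler sums are checked on the matrix coefficients
    [T i j] of the coproduct.  They span [H] and satisfy
    [Delta (T i j) = sum_l T i l ⊗ T l j], so that iterated coproducts become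
    sums over matrix indices, convolution becomes matrix multiplication, and
    the antipode gives the inverse matrix. *)

(** * Linearity of expressions *)

Section Linearity.
Variable k : fieldType.
Implicit Types U V W X : vectType k.

Lemma linear_idfun U : linear (fun x : U => x).
Proof. by []. Qed.

Lemma linear_lfun U V W (L : 'Hom(V, W)) (f : U -> V) :
  linear f -> linear (fun x => L (f x)).
Proof. by move=> Lf a x y; rewrite Lf linearP. Qed.

Lemma linear_lfun_at U V W (f : U -> 'Hom(V, W)) v :
  linear f -> linear (fun x => f x v).
Proof. by move=> Lf a x y; rewrite Lf add_lfunE scale_lfunE. Qed.

Lemma linear_fun U V W (g : V -> W) (f : U -> V) :
  linear g -> linear f -> linear (fun x => g (f x)).
Proof. by move=> Lg Lf a x y; rewrite Lf Lg. Qed.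

Lemma linear_mull U (B : falgType k) (f : U -> B) b :
  linear f -> linear (fun x => f x * b).
Proof. by move=> Lf a x y; rewrite Lf mulrDl scalerAl. Qed.

Lemma linear_mulr U (B : falgType k) (f : U -> B) b :
  linear f -> linear (fun x => b * f x).
Proof. by move=> Lf a x y; rewrite Lf mulrDr scalerAr. Qed.

Lemma linear_scalel U V (f : U -> k^o) (v : V) :
  linear f -> linear (fun x => (f x : k) *: v).
Proof. by move=> Lf a x y; rewrite Lf scalerDl scalerA. Qed.

Lemma linear_scaler U V (f : U -> V) c : linear f -> linear (fun x => c *: f x).
Proof. by move=> Lf a x y; rewrite Lf scalerDr !scalerA mulrC. Qed.

Lemma linear_purel U V W (f : U -> V) (w : W) :
  linear f -> linear (fun x => f x ⊗ w).
Proof. by move=> Lf a x y; rewrite Lf (pure_bilinear _ _).2. Qed.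

Lemma linear_purer U V W (f : U -> V) (w : W) :
  linear f -> linear (fun x => w ⊗ f x).
Proof. by move=> Lf a x y; rewrite Lf (pure_bilinear _ _).1. Qed.

Lemma linear_sw U V W X (f : V -> W -> X) (g : U -> tensor V W) :
  linear g -> linear (fun x => \sw_(v, w <- g x) f v w).
Proof. by move=> Lg a x y; rewrite Lg tlift_is_linear. Qed.

Lemma linear_sw_fun U V W X (f : U -> V -> W -> X) (t : tensor V W) :
  (forall v w, linear (fun x => f x v w)) ->
  linear (fun x => \sw_(v, w <- t) f x v w).
Proof.
move=> Lf a x y; rewrite /tlift scaler_sumr -big_split; apply: eq_bigr => i _ /=.
rewrite scaler_sumr -big_split; apply: eq_bigr => j _ /=.
by rewrite Lf scalerDr !scalerA mulrC.
Qed.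

Lemma eq_sw U V W (f g : U -> V -> W) (t : tensor U V) : f =2 g ->
  \sw_(u, v <- t) f u v = \sw_(u, v <- t) g u v.
Proof. by move=> fg; do 2!apply: eq_bigr => ? _; rewrite fg. Qed.

Lemma sw_sum U V W (I : finType) (f : I -> U -> V -> W) (t : tensor U V) :
  \sw_(u, v <- t) (\sum_i f i u v) = \sum_i \sw_(u, v <- t) f i u v.
Proof.
rewrite /tlift [RHS]exchange_big; apply: eq_bigr => a _.
by rewrite [RHS]exchange_big; apply: eq_bigr => b _; rewrite scaler_sumr.
Qed.

Lemma linear_sumf U V (I : finType) (f : I -> U -> V) :
  (forall i, linear (f i)) -> linear (fun x => \sum_i f i x).
Proof.
move=> Lf a x y; rewrite scaler_sumr -big_split.
by apply: eq_bigr => i _; rewrite Lf.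
Qed.

Lemma linfunE U V (f : U -> V) u : linear f -> linfun f u = f u.
Proof.
move=> Lf; pose m := GRing.isLinear.Build k U V *:%R f Lf.
pose L : {linear U -> V} := HB.pack f m.
by rewrite -[f]/(L : U -> V) lfunE.
Qed.

Lemma linear_linfun U V W (f : U -> V -> W) :
  (forall u, linear (f u)) -> (forall v, linear (f^~ v)) ->
  linear (fun u => linfun (f u)).
Proof.
move=> fr fl a x y; apply/lfunP => v.
by rewrite add_lfunE scale_lfunE !linfunE // fl.
Qed.

Lemma linear_sum_of U V (f : U -> V) : linear f ->
  forall (I : finType) (g : I -> U), f (\sum_i g i) = \sum_i f (g i).
Proof.
move=> Lf I g; rewrite -(linfunE _ Lf) linear_sum.
by apply: eq_bigr => i _; exact: linfunE.
Qed.

Lemma linear_scale_of U V (f : U -> V) : linear f ->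
  forall c u, f (c *: u) = c *: f u.
Proof.
move=> Lf c u; rewrite -[f u](linfunE _ Lf) -linearZ.
by rewrite -[RHS]/(linfun f _) linfunE.
Qed.

Lemma linear0_of U V (f : U -> V) : linear f -> f 0 = 0.
Proof. by move=> Lf; rewrite -(linfunE _ Lf) linear0. Qed.

Lemma linear_sw_of U V W X (L : W -> X) (f : U -> V -> W) (t : tensor U V) :
  linear L -> L (\sw_(u, v <- t) f u v) = \sw_(u, v <- t) L (f u v).
Proof.
move=> LL; rewrite /tlift (linear_sum_of LL); apply: eq_bigr => i _.
rewrite (linear_sum_of LL); apply: eq_bigr => j _.
by rewrite (linear_scale_of LL).
Qed.

Lemma sw_exchange U V U' V' W (f : U -> V -> U' -> V' -> W)
    (t : tensor U V) (t' : tensor U' V') :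
  \sw_(u, v <- t) \sw_(u', v' <- t') f u v u' v' =
  \sw_(u', v' <- t') \sw_(u, v <- t) f u v u' v'.
Proof.
rewrite {1}/tlift [RHS]/tlift.
transitivity (\sum_i \sum_j \sum_i' \sum_j'
    (t i j * t' i' j') *: f (r2v (delta_mx 0 i)) (r2v (delta_mx 0 j))
                            (r2v (delta_mx 0 i')) (r2v (delta_mx 0 j'))).
  apply: eq_bigr => i _; apply: eq_bigr => j _; rewrite scaler_sumr.
  apply: eq_bigr => i' _; rewrite scaler_sumr.
  by apply: eq_bigr => j' _; rewrite scalerA.
under eq_bigr do rewrite exchange_big /=.
rewrite exchange_big; apply: eq_bigr => i' _ /=.
under eq_bigr do rewrite exchange_big /=.
rewrite exchange_big; apply: eq_bigr => j' _ /=.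
rewrite scaler_sumr; apply: eq_bigr => i _; rewrite scaler_sumr.
by apply: eq_bigr => j _; rewrite scalerA mulrC.
Qed.

Lemma row_sum_pure U V (u : 'I_(dim U) -> V) a :
  row a (\sum_i (r2v (delta_mx 0 i) ⊗ u i : tensor U V) : 'M_(_, _)) = v2r (u a).
Proof.
rewrite linear_sum (bigD1 a) //= big1 ?addr0.
  rewrite /pure !r2vK trmx_delta; apply/rowP=> b.
  by rewrite !mxE big_ord1 !mxE !eqxx mul1r.
move=> i ia; apply/rowP=> b; rewrite /pure !r2vK trmx_delta.
by rewrite !mxE big_ord1 !mxE [a == i]eq_sym (negPf ia) mul0r.
Qed.

Lemma tensor_expand U V (t : tensor U V) :
  t = \sum_i (r2v (delta_mx 0 i) ⊗ (r2v (row i t) : V)).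
Proof.
by apply/row_matrixP => a; rewrite row_sum_pure r2vK.
Qed.

Lemma inj_lfun_bij U V (L : 'Hom(U, V)) :
  dim U = dim V -> injective L -> bijective L.
Proof.
move=> dUV /lker0P kL.
have fullL : limg L = fullv.
  apply/eqP; rewrite eqEdim subvf /= (limg_dim_eq (U := fullv)).
    by rewrite !dimvf dUV.
  by rewrite (eqP kL) capv0.
exists (L^-1)%VF; first exact: lker0_lfunK.
by move=> v; rewrite limg_lfunVK // fullL memvf.
Qed.

Lemma surj_lfun_bij U V (L : 'Hom(U, V)) :
  dim U = dim V -> (forall v, exists u, L u = v) -> bijective L.
Proof.
move=> dUV sL; apply: inj_lfun_bij => //; apply/lker0P.
have fullL : limg L = fullv.
  apply/eqP; rewrite eqEsubv subvf; apply/subvP=> v _.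
  by have [u <-] := sL v; rewrite memv_img ?memvf.
have := limg_ker_dim L fullv.
rewrite fullL !dimvf capfv dUV -[X in _ = X]add0n => /eqP.
by rewrite eqn_add2r dimv_eq0.
Qed.

End Linearity.

(** Proves linearity and bilinearity of maps given by an explicit expression,
    by structural recursion on the expression; hypotheses stating that an
    unknown map is linear or bilinear are used wherever they apply. *)
Ltac lin :=
  lazymatch goal with
  | |- is_bilinear _ => split=> ? /=; lin
  | |- forall _, _ => let x := fresh "x" in move=> x; cbv beta; lin
  | |- GRing.linear_for _ ?f =>
    first
    [ assumption
    | match goal with H : is_bilinear _ |- _ =>
        first [ exact: H.1 | exact: H.2
              | apply: (linear_fun (H.1 _)); lin
              | apply: (linear_fun (H.2 _)); lin ] end
    | match goal with H : linear _ |- _ => apply: (linear_fun H); lin end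
    | lazymatch f with
      | fun x => x => exact: linear_idfun
      | fun x => _ => lin_step
      | _ => let g := eval cbv beta in (fun x => f x) in
             lazymatch g with
             | fun x => _ => change (linear (fun x => f x)); cbv beta; lin_step
             end
      end ]
  end
with lin_step :=
  first
  [ exact: linear_idfun
  | apply: linear_scalel; lin
  | apply: linear_scaler; lin
  | apply: linear_purel; lin
  | apply: linear_purer; lin
  | apply: linear_mull; lin
  | apply: linear_mulr; lin
  | apply: linear_lfun; lin
  | apply: linear_lfun_at; lin
  | apply: linear_linfun; lin
  | apply: linear_sw; lin
  | apply: linear_sw_fun; lin
  | apply: linear_sumf; lin ].

(** * Matrix coefficients of the coproduct *)

Section FamilyMatrix.
Variable R : pzRingType.

(** Families are indexed by arbitrary finite types, mostly products, because
    a product of coalgebras has pairs as indices; matrices provide the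
    associative multiplication. *)
Definition family_mx (I : finType) (X : I -> I -> R) : 'M[R]_#|I| :=
  \matrix_(a, b) X (enum_val a) (enum_val b).

Lemma family_mx_eq (I : finType) (X Y : I -> I -> R) :
  family_mx X = family_mx Y <-> X =2 Y.
Proof.
split=> [/matrixP XY i j | XY]; last by apply/matrixP=> a b; rewrite !mxE XY.
by move: (XY (enum_rank i) (enum_rank j)); rewrite !mxE !enum_rankK.
Qed.

Lemma family_mxM (I : finType) (X Y : I -> I -> R) :
  family_mx X *m family_mx Y = family_mx (fun i j => \sum_l X i l * Y l j).
Proof.
apply/matrixP=> a b; rewrite !mxE.
rewrite (reindex (@enum_val I predT)) /=; last first.
  by apply: onW_bij; exact: enum_val_bij.
by apply: eq_bigr => c _; rewrite !mxE.
Qed.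

Lemma family_mx1 (I : finType) :
  family_mx (fun i j : I => (i == j)%:R) = 1%:M.
Proof. by apply/matrixP=> a b; rewrite !mxE (inj_eq enum_val_inj). Qed.

End FamilyMatrix.

Section DeltaSums.
Variables (R : pzRingType) (V : lmodType R) (I : finType).

Lemma sum_deltal (F : I -> V) i : \sum_l (i == l)%:R *: F l = F i.
Proof.
rewrite (bigD1 i) //= eqxx scale1r big1 ?addr0 // => l.
by rewrite eq_sym => /negPf->; rewrite scale0r.
Qed.

Lemma sum_deltar (F : I -> V) i : \sum_l (l == i)%:R *: F l = F i.
Proof. by rewrite -[RHS]sum_deltal; apply: eq_bigr => l _; rewrite eq_sym. Qed.

Lemma sum_mul_deltal (F : I -> R) i : \sum_l (i == l)%:R * F l = F i.
Proof.
rewrite (bigD1 i) //= eqxx mul1r big1 ?addr0 // => l.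
by rewrite eq_sym => /negPf->; rewrite mul0r.
Qed.

Lemma sum_mul_deltar (F : I -> R) i : \sum_l F l * (l == i)%:R = F i.
Proof.
rewrite (bigD1 i) //= eqxx mulr1 big1 ?addr0 // => l /negPf->.
by rewrite mulr0.
Qed.

End DeltaSums.

Section MatrixCoefficients.
Variables (k : fieldType) (H : hopfType k).

(** A finite-dimensional comodule is the same thing as a square family [X] with
    this coproduct and counit; a Sweedler sum over [X i j] is then a matrix
    product. *)
Definition comatrix (I : finType) (X : I -> I -> H) : Prop :=
  (forall i j, Delta (X i j) = \sum_l (X i l ⊗ X l j)) /\
  (forall i j, eps (X i j) = (i == j)%:R).

Lemma sw_comatrix (I : finType) (X : I -> I -> H) : comatrix X ->
  forall (W : vectType k) (f : H -> H -> W) i j, is_bilinear f ->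
  \sw_(x, y <- Delta (X i j)) f x y = \sum_l f (X i l) (X l j).
Proof.
move=> [DX _] W f i j bf; rewrite DX (linear_sum_of (tlift_is_linear f)).
by apply: eq_bigr => l _; rewrite tliftE.
Qed.

Lemma sw2_comatrix (I J : finType) (X : I -> I -> H) (Y : J -> J -> H) :
  comatrix X -> comatrix Y ->
  forall (W : vectType k) (f : H -> H -> H -> H -> W) i j p q,
  (forall x1 x2, is_bilinear (f x1 x2)) ->
  is_bilinear (fun x1 x2 => \sw_(y1, y2 <- Delta (Y p q)) f x1 x2 y1 y2) ->
  \sw_(x1, x2 <- Delta (X i j)) \sw_(y1, y2 <- Delta (Y p q)) f x1 x2 y1 y2 =
  \sum_l \sum_n f (X i l) (X l j) (Y p n) (Y n q).
Proof.
move=> cX cY W f i j p q bf bsw; rewrite sw_comatrix //.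
by apply: eq_bigr => l _; rewrite sw_comatrix.
Qed.

Let base i : H := r2v (delta_mx 0 i).

(** The coefficients of [H] as a right comodule over itself, in the standard
    basis. *)
Definition coef (i j : 'I_(dim H)) : H := r2v (row i (Delta (base j))).

Let Delta_base j : Delta (base j) = \sum_i (base i ⊗ coef i j).
Proof. exact: tensor_expand. Qed.

Let base_pure_inj (U : vectType k) (u v : 'I_(dim H) -> U) :
  \sum_i (base i ⊗ u i) = \sum_i (base i ⊗ v i) -> u =1 v.
Proof.
by move=> uv a; apply: (can_inj v2rK); rewrite -!row_sum_pure uv.
Qed.

Let sw_base (W : vectType k) (f : H -> H -> W) j : is_bilinear f ->
  \sw_(x, y <- Delta (base j)) f x y = \sum_i f (base i) (coef i j).
Proof.
move=> bf; rewrite Delta_base (linear_sum_of (tlift_is_linear f)).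
by apply: eq_bigr => i _; rewrite tliftE.
Qed.

(** Coassociativity and the right counit law, compared coefficientwise on the
    linearly independent vectors [base i]. *)
Lemma comatrix_coef : comatrix coef.
Proof.
have Dc i j : Delta (coef i j) = \sum_l (coef i l ⊗ coef l j).
  move: i; apply: base_pure_inj.
  transitivity (\sw_(h1, h2 <- Delta (base j)) (h1 ⊗ Delta h2)).
    by rewrite sw_base //; lin.
  transitivity (\sw_(h1, h2 <- Delta (base j))
     \sw_(h21, h22 <- Delta h2) (h1 ⊗ (h21 ⊗ h22))).
    rewrite !sw_base; try lin; apply: eq_bigr => i _.
    pose f (t : tensor H H) := \sw_(x, y <- t) (base i ⊗ (x ⊗ y)).
    apply: (tensor_ext (f := fun t => base i ⊗ t) (g := f)); rewrite /f; try lin.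
    by move=> u v; rewrite tliftE //; lin.
  rewrite -coassoc_subproof sw_base; last by lin.
  under eq_bigr => l _ do (rewrite sw_base; last by lin).
  rewrite exchange_big; apply: eq_bigr => i _.
  by rewrite (linear_sum_of (f := fun t => base i ⊗ t)) //; lin.
split=> // i j.
have /base_pure_inj : \sum_i (base i ⊗ (eps (coef i j) : k^o)) =
    \sum_i (base i ⊗ ((i == j)%:R : k^o)).
  transitivity ((\sw_(h1, h2 <- Delta (base j)) ((eps h2 : k) *: h1) : H)
                  ⊗ (1 : k^o)).
    rewrite sw_base; last by lin.
    rewrite (linear_sum_of (f := fun t => t ⊗ (1 : k^o))); last by lin.
    apply: eq_bigr => l _.
    have ZE (c : k) : (c *: base l) ⊗ (1 : k^o) = base l ⊗ (c : k^o).
      rewrite (linear_scale_of (f := fun t => t ⊗ (1 : k^o))); last by lin.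
      rewrite -(linear_scale_of (f := fun t => base l ⊗ t)); last by lin.
      by rewrite [c *: _]mulr1.
    by rewrite ZE.
  rewrite counitr_subproof (bigD1 j) //= eqxx big1 ?addr0 // => l /negPf->.
  by rewrite (linear0_of (f := fun t => base l ⊗ t)) //; lin.
by apply.
Qed.

(** By the left counit law, [base j = sum_i eps(base i) coef i j]. *)
Lemma coef_span h : exists c, h = \sum_i \sum_j c i j *: coef i j.
Proof.
exists (fun i j => v2r h 0 j * eps (base i)).
transitivity (\sum_j v2r h 0 j *: base j).
  rewrite -{1}[h]v2rK {1}[v2r h]row_sum_delta linear_sum.
  by apply: eq_bigr => j _; rewrite linearZ.
rewrite [RHS]exchange_big; apply: eq_bigr => j _ /=.
rewrite -[base j in LHS]counitl_subproof.
rewrite sw_base; last by lin.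
by rewrite scaler_sumr; apply: eq_bigr => i _; rewrite scalerA.
Qed.

Lemma linear_coef_ext (W : vectType k) (f g : H -> W) :
  linear f -> linear g -> (forall i j, f (coef i j) = g (coef i j)) -> f =1 g.
Proof.
move=> Lf Lg fg h; have [c ->] := coef_span h.
rewrite (linear_sum_of Lf) (linear_sum_of Lg); apply: eq_bigr => i _.
rewrite (linear_sum_of Lf) (linear_sum_of Lg); apply: eq_bigr => j _.
by rewrite (linear_scale_of Lf) (linear_scale_of Lg) fg.
Qed.

Lemma bilinear_coef_ext (W : vectType k) (f g : H -> H -> W) :
  is_bilinear f -> is_bilinear g ->
  (forall i j p q, f (coef i j) (coef p q) = g (coef i j) (coef p q)) -> f =2 g.
Proof.
move=> bf bg fg x y; move: x.
apply: linear_coef_ext (bf.2 y) (bg.2 y) _ => i j.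
exact: linear_coef_ext (bf.1 _) (bg.1 _) _ y.
Qed.

End MatrixCoefficients.

(** * Products of families and the antipode *)

Section HopfFamilies.
Variables (k : fieldType) (H : hopfType k).
Implicit Types I J : finType.

Local Notation S := (@antipode k H).
Local Notation T := (@coef k H).

Lemma comatrix_mul I J (X : I -> I -> H) (Y : J -> J -> H) :
  comatrix X -> comatrix Y ->
  comatrix (fun u v : I * J => X u.1 v.1 * Y u.2 v.2).
Proof.
move=> cX cY; split=> u v; last first.
  by rewrite epsM_subproof cX.2 cY.2 -natrM mulnb -xpair_eqE -!surjective_pairing.
by rewrite DeltaM_subproof sw2_comatrix //; [rewrite pair_bigA | lin | lin].
Qed.

Lemma antipodel_comatrix I (X : I -> I -> H) i j : comatrix X ->
  \sum_l S (X i l) * X l j = (i == j)%:R.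
Proof.
move=> cX; move: (antipodel_subproof (X i j)).
rewrite sw_comatrix //; last by lin.
by move=> ->; rewrite cX.2 scaler_nat.
Qed.

Lemma antipoder_comatrix I (X : I -> I -> H) i j : comatrix X ->
  \sum_l X i l * S (X l j) = (i == j)%:R.
Proof.
move=> cX; move: (antipoder_subproof (X i j)).
rewrite sw_comatrix //; last by lin.
by move=> ->; rewrite cX.2 scaler_nat.
Qed.

Lemma left_right_inverse_family I (L X R : I -> I -> H) :
  (forall i j, \sum_l L i l * X l j = (i == j)%:R) ->
  (forall i j, \sum_l X i l * R l j = (i == j)%:R) -> L =2 R.
Proof.
move=> /family_mx_eq LX /family_mx_eq XR.
move: LX XR; rewrite -!family_mxM !family_mx1 => LX XR; apply/family_mx_eq.
by rewrite -[LHS]mulmx1 -XR mulmxA LX mul1mx.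
Qed.

Lemma antipode1 : S 1 = 1.
Proof.
move: (antipodel_subproof (1 : H)); rewrite Delta1_subproof tliftE; last by lin.
by rewrite mulr1 eps1_subproof scale1r.
Qed.

(** Both sides are inverse to the matrix with entries [T u.1 v.1 * T u.2 v.2]. *)
Lemma antipodeM x y : S (x * y) = S y * S x.
Proof.
move: x y; apply: bilinear_coef_ext; try lin.
move=> i j p q; have cT := @comatrix_coef k H.
have cTT := comatrix_mul cT cT.
suff ST : (fun u v => S (T u.1 v.1 * T u.2 v.2)) =2
          (fun u v => S (T u.2 v.2) * S (T u.1 v.1)) by exact: ST (i, p) (j, q).
apply: left_right_inverse_family => u v; first exact: antipodel_comatrix cTT.
rewrite -(pair_bigA _ (fun a b =>
  T u.1 a * T u.2 b * (S (T b v.2) * S (T a v.1)))).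
transitivity (\sum_a T u.1 a * (\sum_b T u.2 b * S (T b v.2)) * S (T a v.1)).
  apply: eq_bigr => a _; rewrite mulr_sumr mulr_suml.
  by apply: eq_bigr => b _; rewrite !mulrA.
under eq_bigr do rewrite antipoder_comatrix // mulr_natr mulrnAl.
rewrite sumrMnl antipoder_comatrix // -mulrnA mulnb -xpair_eqE.
by rewrite -!surjective_pairing.
Qed.

Lemma eps_antipode x : eps (S x) = eps x.
Proof.
have cT := @comatrix_coef k H.
move: x; apply: linear_coef_ext; try lin; move=> i j.
have /(congr1 (@eps k H)) := antipodel_comatrix i j cT.
rewrite linear_sum [eps _%:R]raddfMn /= eps1_subproof cT.2 => <-.
rewrite -[LHS](sum_deltar (fun l => eps (S (T i l)) : k^o)); apply: eq_bigr => l _.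
by rewrite epsM_subproof cT.2 mulrC.
Qed.

(** Right multiplication by [a ⊗ b] in the algebra [H ⊗ H]. *)
Let act (t : tensor H H) a b : tensor H H := \sw_(x, y <- t) ((x * a) ⊗ (y * b)).

Let actE x y a b : act (x ⊗ y) a b = (x * a) ⊗ (y * b).
Proof. by rewrite /act tliftE //; lin. Qed.

Let act_act t a b c d : act (act t a b) c d = act t (a * c) (b * d).
Proof.
move: t; apply: tensor_ext; rewrite /act; try lin.
by move=> u v; rewrite -!/(act _ _ _) !actE !mulrA.
Qed.

Let act_suml I (F : I -> tensor H H) a b :
  \sum_i act (F i) a b = act (\sum_i F i) a b.
Proof.
by rewrite (linear_sum_of (f := fun t => act t a b)) //; rewrite /act; lin.
Qed.

Let act_sum1 I t (F : I -> H) b :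
  \sum_i act t (F i) b = act t (\sum_i F i) b.
Proof.
by rewrite (linear_sum_of (f := fun a => act t a b)) //; rewrite /act; lin.
Qed.

Let act_sum2 I t a (F : I -> H) :
  \sum_i act t a (F i) = act t a (\sum_i F i).
Proof.
by rewrite (linear_sum_of (f := fun b => act t a b)) //; rewrite /act; lin.
Qed.

Let act1 t : act t 1 1 = t.
Proof.
move: t; apply: tensor_ext; rewrite /act; try lin.
by move=> u v; rewrite -/(act _ _ _) actE !mulr1.
Qed.

(** Uniqueness of inverses in matrices over [H ⊗ H]: on the family [T], both
    sides are inverse to [Delta (T i j)]. *)
Lemma Delta_antipode x : Delta (S x) = \sw_(x1, x2 <- Delta x) (S x2 ⊗ S x1).
Proof.
have cT := @comatrix_coef k H.
move: x; apply: linear_coef_ext; try lin.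
move=> i j; rewrite sw_comatrix //; last by lin.
have DST b : \sum_m \sum_a act (Delta (S (T i m))) (T m a) (T a b) =
    ((i == b)%:R : k) *: (1 ⊗ 1).
  rewrite -Delta1_subproof -linearZ scaler_nat -(antipodel_comatrix _ _ cT).
  rewrite linear_sum; apply: eq_bigr => m _ /=.
  rewrite DeltaM_subproof -sw_sum; apply: eq_sw => x y.
  by rewrite sw_comatrix //; lin.
(* The right factor [1 ⊗ 1] of [Delta (S (T i j))] is expanded as
   [h1 S(h4) ⊗ h2 S(h3)], whose part [h1 ⊗ h2] is then absorbed by [DST]. *)
transitivity (\sum_m \sum_a act (Delta (S (T i m))) (T m a * S (T a j)) 1).
  under eq_bigr do rewrite act_sum1 antipoder_comatrix //.
  rewrite (bigD1 j) //= eqxx act1 big1 ?addr0 // => m /negPf->.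
  by rewrite (linear0_of (f := fun a => act _ a 1)) //; rewrite /act; lin.
transitivity (\sum_m \sum_a \sum_c \sum_b
    act (act (Delta (S (T i m))) (T m a) (T a b)) (S (T c j)) (S (T b c))).
  apply: eq_bigr => m _; apply: eq_bigr => a _.
  under eq_bigr do under eq_bigr do rewrite act_act.
  under eq_bigr do rewrite act_sum2 antipoder_comatrix //.
  rewrite (bigD1 a) //= eqxx big1 ?addr0 // => c; rewrite eq_sym => /negPf->.
  by rewrite (linear0_of (f := fun b => act _ _ b)) //; rewrite /act; lin.
under eq_bigr do rewrite exchange_big /=.
rewrite exchange_big /=; apply: eq_bigr => c _.
under eq_bigr do rewrite exchange_big /=.
rewrite exchange_big /=.
transitivity (\sum_b ((i == b)%:R : k) *: (S (T c j) ⊗ S (T b c))).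
  apply: eq_bigr => b _.
  under eq_bigr do rewrite act_suml.
  rewrite act_suml DST (linear_scale_of (f := fun t => act t _ _)).
    by rewrite actE !mul1r.
  by rewrite /act; lin.
exact: sum_deltal.
Qed.

Lemma comatrix_antipode I (X : I -> I -> H) :
  comatrix X -> comatrix (fun i j => S (X j i)).
Proof.
move=> cX; split=> i j; last by rewrite eps_antipode cX.2 eq_sym.
by rewrite Delta_antipode sw_comatrix //; lin.
Qed.

End HopfFamilies.

(** * Convolution of bilinear forms *)

Section Convolution.
Variables (k : fieldType) (H : hopfType k).
Implicit Types (I J : finType) (f g : dual (tensor H H)).

Lemma conv_pure f g x y :
  conv f g (x ⊗ y) = \sw_(x1, x2 <- Delta x) \sw_(y1, y2 <- Delta y)
    (f (x1 ⊗ y1) * g (x2 ⊗ y2) : k^o).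
Proof. by rewrite linfunE; [rewrite tliftE //; lin | lin]. Qed.

Lemma conv1_pure x y : @conv1 k H (x ⊗ y) = eps x * eps y.
Proof. by rewrite linfunE; [rewrite tliftE //; lin | lin]. Qed.

Lemma flip_pure (U V : vectType k) (u : U) (v : V) : flip U V (u ⊗ v) = v ⊗ u.
Proof. by rewrite linfunE; [rewrite tliftE //; lin | lin]. Qed.

Definition form_mx I J f (X : I -> I -> H) (Y : J -> J -> H) :
    'M[k]_#|{: I * J}| :=
  family_mx (fun u v => f (X u.1 v.1 ⊗ Y u.2 v.2)).

Lemma form_mx_conv I J f g (X : I -> I -> H) (Y : J -> J -> H) :
  comatrix X -> comatrix Y ->
  form_mx (conv f g) X Y = form_mx f X Y *m form_mx g X Y.
Proof.
move=> cX cY; rewrite family_mxM; apply/family_mx_eq => u v.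
by rewrite conv_pure sw2_comatrix //; [rewrite pair_bigA | lin | lin].
Qed.

Lemma form_mx_conv1 I J (X : I -> I -> H) (Y : J -> J -> H) :
  comatrix X -> comatrix Y -> form_mx (@conv1 k H) X Y = 1%:M.
Proof.
move=> cX cY; rewrite -family_mx1; apply/family_mx_eq => u v.
rewrite conv1_pure cX.2 cY.2 -[LHS]/((u.1 == v.1)%:R * (u.2 == v.2)%:R : k).
by rewrite -natrM mulnb -xpair_eqE -!surjective_pairing.
Qed.

End Convolution.

(** * Bijectivity of the antipode *)

Section AntipodeBijective.
Variables (k : fieldType) (H : hopfType k) (r : dual (tensor H H)).
Hypothesis r_rform : universal_rform r.

Local Notation S := (@antipode k H).
Local Notation T := (@coef k H).

(** The functional [r(-, 1)] is idempotent and right invertible for the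
    convolution product. *)
Lemma rform_unitr x : r (x ⊗ 1) = eps x.
Proof.
have cT := @comatrix_coef k H.
have [[rb [rrb _]] _ rM _] := r_rform.
have Lr : linear (fun x : H => r (x ⊗ (1 : H))) by lin.
have Le : linear (@eps k H) by lin.
apply: (linear_coef_ext Lr Le).
move=> i j; pose E := family_mx (fun i j => r (T i j ⊗ 1) : k).
pose Eb := family_mx (fun i j => rb (T i j ⊗ 1) : k).
have EEb : E *m Eb = 1%:M.
  rewrite family_mxM -family_mx1; apply/family_mx_eq => a b.
  have /(congr1 (fun f : dual (tensor H H) => f (T a b ⊗ 1))) := rrb.
  rewrite conv_pure conv1_pure eps1_subproof mulr1 cT.2 => <-.
  rewrite sw_comatrix //; last by lin.
  by apply: eq_bigr => l _; rewrite Delta1_subproof tliftE //; lin.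
have EE : E *m E = E.
  rewrite family_mxM; apply/family_mx_eq => a b.
  by rewrite -[in RHS](mulr1 (1 : H)) rM sw_comatrix //; lin.
have : E = 1%:M by rewrite -EEb -[E in RHS]EE -mulmxA EEb mulmx1.
by rewrite cT.2 -family_mx1 => /family_mx_eq.
Qed.

(** The functional [f(x) = r(x1, S x2)] satisfies [x1 f(x2) = f(x1) S(S x2)]
    and has the convolution right inverse [g(x) = r(S(S x1), x2)]; hence
    [x = S (f(x1) S(x2) g(x3))]. *)
Lemma antipode_surj x : exists y, S y = x.
Proof.
have cT := @comatrix_coef k H; have cS := comatrix_antipode cT.
have [_ _ rMr rC] := r_rform.
pose f i j := \sum_l (r (T i l ⊗ S (T l j)) : k).
pose g i j := \sum_l (r (S (S (T i l)) ⊗ T l j) : k).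
(* The commutation axiom of [r] at [x1] and [S x2]. *)
have fE i j : f i j *: 1 = \sum_q \sum_p f p q *: (S (T q j) * T i p).
  pose F a := \sw_(x1, x2 <- Delta (T i a)) \sw_(y1, y2 <- Delta (S (T a j)))
    (r (x1 ⊗ y1) *: (x2 * y2)).
  transitivity (\sum_a F a).
    under [RHS]eq_bigr => a _.
      rewrite /F (sw2_comatrix cT cS); [ | lin | lin].
      over.
    rewrite exchange_big scaler_suml; apply: eq_bigr => p _ /=.
    rewrite exchange_big /=.
    under eq_bigr do rewrite -scaler_sumr antipoder_comatrix //.
    rewrite (bigD1 p) //= eqxx big1 ?addr0 // => q; rewrite eq_sym => /negPf->.
    by rewrite scaler0.
  under eq_bigr => a _.
    rewrite /F -rC (sw2_comatrix cT cS); [ | lin | lin].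
    over.
  rewrite exchange_big [RHS]exchange_big; apply: eq_bigr => p _ /=.
  rewrite exchange_big; apply: eq_bigr => q _ /=.
  by rewrite scaler_suml.
have fSS i m : \sum_j f i j *: S (S (T j m)) = \sum_p f p m *: T i p.
  transitivity (\sum_j S (S (T j m)) * (f i j *: 1)).
    by apply: eq_bigr => j _; rewrite -scalerAr mulr1.
  transitivity (\sum_q \sum_p f p q *: ((q == m)%:R * T i p)).
    under eq_bigr do rewrite fE mulr_sumr.
    rewrite exchange_big; apply: eq_bigr => q _ /=.
    under eq_bigr do rewrite mulr_sumr.
    rewrite exchange_big; apply: eq_bigr => p _ /=.
    under eq_bigr do rewrite -scalerAr mulrA -antipodeM.
    rewrite -scaler_sumr -mulr_suml -linear_sum antipoder_comatrix //.
    by rewrite raddfMn /= antipode1.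
  rewrite (bigD1 m) //= eqxx [X in _ + X]big1 ?addr0 => [|q /negPf->].
    by apply: eq_bigr => p _; rewrite mul1r.
  by rewrite big1 // => p _; rewrite mul0r scaler0.
have br : is_bilinear (fun x y => r (x ⊗ y)) by lin.
have fg i j : \sum_m f i m * g m j = (i == j)%:R.
  transitivity (\sum_l (r ((\sum_m f i m *: S (S (T m l))) ⊗ T l j) : k)).
    under eq_bigr do rewrite mulr_sumr.
    rewrite exchange_big; apply: eq_bigr => l _ /=.
    rewrite (linear_sum_of (br.2 _)); apply: eq_bigr => m _.
    by rewrite (linear_scale_of (br.2 _)).
  transitivity (\sum_a \sum_l (r (T i a ⊗ (S (T a l) * T l j)) : k)).
    rewrite exchange_big; apply: eq_bigr => l _ /=.
    rewrite fSS (linear_sum_of (br.2 _)).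
    under [RHS]eq_bigr => a _ do (rewrite rMr sw_comatrix //; last by lin).
    rewrite exchange_big; apply: eq_bigr => p _ /=.
    rewrite (linear_scale_of (br.2 _)) scaler_suml; apply: eq_bigr => a _.
    exact: mulrC.
  transitivity (\sum_a ((a == j)%:R : k) *: (r (T i a ⊗ 1) : k^o)).
    apply: eq_bigr => a _.
    rewrite -(linear_sum_of (br.1 _)) antipodel_comatrix // -scaler_nat.
    exact: (linear_scale_of (br.1 _)).
  by rewrite sum_deltar rform_unitr cT.2.
pose Z i j := \sum_l \sum_m (f i l * g m j) *: S (T l m).
have SZ i j : S (Z i j) = T i j.
  transitivity (\sum_m \sum_p (f p m * g m j) *: T i p).
    rewrite linear_sum; under eq_bigr do rewrite linear_sum.
    rewrite exchange_big /=; apply: eq_bigr => m _.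
    under eq_bigr do rewrite linearZ /= mulrC -scalerA.
    rewrite -scaler_sumr fSS scaler_sumr; apply: eq_bigr => p _.
    by rewrite scalerA mulrC.
  rewrite exchange_big /=; under eq_bigr do rewrite -scaler_suml fg.
  exact: sum_deltar.
have [c ->] := coef_span x; exists (\sum_i \sum_j c i j *: Z i j).
rewrite linear_sum; apply: eq_bigr => i _; rewrite linear_sum.
by apply: eq_bigr => j _; rewrite linearZ /= SZ.
Qed.

Lemma antipode_bij : bijective S.
Proof. exact: surj_lfun_bij antipode_surj. Qed.

End AntipodeBijective.

(** * Convolution inverses for cocycle twists *)

(** The data [mu], [S], [s] stand for the product and antipode of [H] with a
    cocycle, and also for those of the opposite Hopf algebra of [H]; both have
    the coproduct and unit of [H]. *)
Section Cleaving.
Variables (k : fieldType) (H : hopfType k).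

Local Notation T := (@coef k H).

Variables (mu : H -> H -> H) (S : H -> H) (s sb : dual (tensor H H)).
Hypothesis mu_bilinear : is_bilinear mu.
Hypothesis comatrix_mu : forall (I J : finType) (X : I -> I -> H)
  (Y : J -> J -> H), comatrix X -> comatrix Y ->
  comatrix (fun u v : I * J => mu (X u.1 v.1) (Y u.2 v.2)).
Hypothesis S_linear : linear S.
Hypothesis comatrix_S : comatrix (fun i j => S (T j i)).
Hypothesis Sl : forall i j, \sum_l mu (S (T i l)) (T l j) = (i == j)%:R.
Hypothesis Sr : forall i j, \sum_l mu (T i l) (S (T l j)) = (i == j)%:R.
Hypothesis s_inverse : conv_inverse s sb.
Hypothesis s_unitr : forall h, s (h ⊗ 1) = eps h.
Hypothesis s_unitl : forall h, s (1 ⊗ h) = eps h.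
Hypothesis s_cocycle : forall h l m,
  \sw_(l1, l2 <- Delta l) \sw_(m1, m2 <- Delta m)
    (s (l1 ⊗ m1) * s (h ⊗ mu l2 m2) : k^o) =
  \sw_(h1, h2 <- Delta h) \sw_(l1, l2 <- Delta l)
    (s (h1 ⊗ l1) * s (mu h2 l2 ⊗ m) : k^o).

Lemma sb_unitl h : sb (1 ⊗ h) = eps h.
Proof.
have cT := @comatrix_coef k H.
move: h; apply: linear_coef_ext; try lin; move=> i j.
have [/(congr1 (fun f : dual (tensor H H) => f (1 ⊗ T i j))) + _] := s_inverse.
rewrite conv_pure conv1_pure eps1_subproof mul1r Delta1_subproof => <-.
rewrite tliftE; last by lin.
rewrite sw_comatrix //; last by lin.
by under eq_bigr do rewrite s_unitl cT.2; rewrite (sum_deltal (V := k^o)).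
Qed.

Section TripleCocycle.
Variables (I J K : finType).
Variables (X : I -> I -> H) (Y : J -> J -> H) (Z : K -> K -> H).
Hypotheses (cX : comatrix X) (cY : comatrix Y) (cZ : comatrix Z).

Lemma cocycle_comatrix i j p q a b :
  \sum_p' \sum_a' s (Y p p' ⊗ Z a a') * s (X i j ⊗ mu (Y p' q) (Z a' b)) =
  \sum_j' \sum_p' s (X i j' ⊗ Y p p') * s (mu (X j' j) (Y p' q) ⊗ Z a b) :> k.
Proof.
have := s_cocycle (X i j) (Y p q) (Z a b).
rewrite (sw2_comatrix cY cZ); [ | lin | lin].
by rewrite (sw2_comatrix cX cY); [ | lin | lin].
Qed.

(** In the convolution algebra on three factors the cocycle identity reads
    [A * B = C * D] with [A = eps ⊗ s], [B = s(id ⊗ mu)], [C = s ⊗ eps] and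
    [D = s(mu ⊗ id)]; this is the consequence [B * D^-1 = A^-1 * C]. *)
Lemma cocycle_inverse_comatrix i j p q a b :
  \sum_j' \sum_p' \sum_a'
     s (X i j' ⊗ mu (Y p p') (Z a a')) * sb (mu (X j' j) (Y p' q) ⊗ Z a' b) =
  \sum_p' sb (Y p p' ⊗ Z a b) * s (X i j ⊗ Y p' q) :> k.
Proof.
have [ssb sbs] := s_inverse.
pose A (f : dual (tensor H H)) := family_mx (fun u v : I * J * K =>
  (u.1.1 == v.1.1)%:R * (f (Y u.1.2 v.1.2 ⊗ Z u.2 v.2) : k)).
pose B := family_mx (fun u v : I * J * K =>
  s (X u.1.1 v.1.1 ⊗ mu (Y u.1.2 v.1.2) (Z u.2 v.2)) : k).
pose C := family_mx (fun u v : I * J * K =>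
  (s (X u.1.1 v.1.1 ⊗ Y u.1.2 v.1.2) : k) * (u.2 == v.2)%:R).
pose D (f : dual (tensor H H)) :=
  form_mx f (fun u v => mu (X u.1 v.1) (Y u.2 v.2)) Z.
have sum3 (F : I * J * K -> k) : \sum_w F w = \sum_i \sum_p \sum_a F (i, p, a).
  rewrite (pair_bigA _ (fun i p => \sum_a F (i, p, a))) pair_bigA.
  by apply: eq_bigr => -[[]].
have AA : A sb *m A s = 1%:M.
  rewrite family_mxM -family_mx1.
  apply/family_mx_eq => -[[i1 p1] a1] [[i2 p2] a2] /=.
  rewrite sum3 /=.
  under eq_bigr do under eq_bigr do under eq_bigr do rewrite mulrACA.
  under eq_bigr do under eq_bigr do rewrite -mulr_sumr.
  under eq_bigr do rewrite -mulr_sumr -mulrA.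
  rewrite sum_mul_deltal.
  have : form_mx (conv sb s) Y Z = 1%:M by rewrite sbs form_mx_conv1.
  rewrite form_mx_conv // family_mxM -family_mx1 => /family_mx_eq.
  move/(_ (p1, a1) (p2, a2)) => /= YZ; rewrite pair_bigA /= YZ.
  by rewrite -natrM mulnb -xpair_eqE !xpair_eqE andbA.
have AB : A s *m B = C *m D s.
  rewrite !family_mxM; apply/family_mx_eq => -[[i1 p1] a1] [[i2 p2] a2] /=.
  rewrite !sum3 /=.
  under eq_bigr do under eq_bigr do under eq_bigr do rewrite -mulrA.
  under eq_bigr do under eq_bigr do rewrite -mulr_sumr.
  under eq_bigr do rewrite -mulr_sumr.
  rewrite sum_mul_deltal cocycle_comatrix; apply: eq_bigr => i3 _.
  apply: eq_bigr => p3 _; under eq_bigr do rewrite -mulrA.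
  by rewrite -mulr_sumr sum_mul_deltal.
have DD : D s *m D sb = 1%:M.
  by rewrite -form_mx_conv ?ssb ?form_mx_conv1 //; exact: comatrix_mu.
have : B *m D sb = A sb *m C.
  rewrite -[B]mul1mx -AA -!mulmxA; congr (_ *m _).
  by rewrite mulmxA AB -mulmxA DD mulmx1.
rewrite !family_mxM => /family_mx_eq /(_ (i, p, a) (j, q, b)) /=.
rewrite !sum3 /= => ->.
under eq_bigr do under eq_bigr do under eq_bigr do rewrite -mulrA.
under eq_bigr do under eq_bigr do rewrite -mulr_sumr.
under eq_bigr do rewrite -mulr_sumr.
rewrite sum_mul_deltal; apply: eq_bigr => p3 _.
under eq_bigr do rewrite mulrA.
by rewrite sum_mul_deltar.
Qed.

End TripleCocycle.

Definition twisted_mul a b : H :=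
  \sw_(a1, a2 <- Delta a) \sw_(b1, b2 <- Delta b) ((s (b1 ⊗ a1) : k) *: mu b2 a2).

Lemma twisted_mul_bilinear : is_bilinear twisted_mul.
Proof. by rewrite /twisted_mul; lin. Qed.

Lemma twisted_mul_comatrix (I J : finType) (X : I -> I -> H) (Y : J -> J -> H)
    i j p q : comatrix X -> comatrix Y ->
  twisted_mul (X i j) (Y p q) =
  \sum_l \sum_m ((s (Y p m ⊗ X i l) : k) *: mu (Y m q) (X l j)).
Proof.
by move=> cX cY; rewrite /twisted_mul sw2_comatrix //; lin.
Qed.

Definition cleft_inverse c : H :=
  \sw_(c1, y <- Delta c) \sw_(c2, c3 <- Delta y) ((sb (S c2 ⊗ c3) : k) *: S c1).

Lemma cleft_inverse_linear : linear cleft_inverse.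
Proof. rewrite /cleft_inverse; lin. Qed.

(** The functional [s(c1, S c2)] has the right inverse [sb(S c1, c2)]:
    evaluate [cocycle_inverse_comatrix] at [c1], [S c2], [c3]; its left-hand
    side then collapses by the antipode axioms. *)
Let sum_s_sb i j :
  \sum_m (\sum_l s (T i l ⊗ S (T l m))) * (\sum_l sb (S (T m l) ⊗ T l j)) =
  (i == j)%:R :> k.
Proof.
have cT := @comatrix_coef k H.
transitivity (\sum_l \sum_l' \sum_m
    (sb (S (T m l') ⊗ T l' j) : k) * (s (T i l ⊗ S (T l m)) : k)).
  under eq_bigr do rewrite mulr_suml.
  rewrite exchange_big; apply: eq_bigr => l _ /=.
  under eq_bigr do rewrite mulr_sumr.
  rewrite exchange_big; apply: eq_bigr => l' _ /=.
  by apply: eq_bigr => m _; exact: mulrC.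
under eq_bigr => l _ do under eq_bigr => l' _ do
  rewrite -(cocycle_inverse_comatrix cT comatrix_S cT).
have bs : is_bilinear (fun x y : H => s (x ⊗ y)) by lin.
have bsb : is_bilinear (fun x y : H => sb (x ⊗ y)) by lin.
transitivity (\sum_l \sum_j' \sum_p' \sum_a'
    (s (T i j' ⊗ ((p' == a')%:R : H)) : k) *
    (sb (mu (T j' l) (S (T l p')) ⊗ T a' j) : k)).
  apply: eq_bigr => l _; rewrite exchange_big; apply: eq_bigr => j' _ /=.
  rewrite exchange_big; apply: eq_bigr => p' _ /=.
  rewrite exchange_big; apply: eq_bigr => a' _ /=.
  by rewrite -mulr_suml -(linear_sum_of (bs.1 _)) Sl.
transitivity (\sum_j' \sum_p' \sum_a'
    (s (T i j' ⊗ ((p' == a')%:R : H)) : k) *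
    (sb ((j' == p')%:R ⊗ T a' j) : k)).
  rewrite exchange_big; apply: eq_bigr => j' _ /=.
  rewrite exchange_big; apply: eq_bigr => p' _ /=.
  rewrite exchange_big; apply: eq_bigr => a' _ /=.
  by rewrite -mulr_sumr -(linear_sum_of (bsb.2 _)) Sr.
have sE x (b : bool) : s (x ⊗ (b%:R : H)) = b%:R * eps x.
  by case: b; rewrite ?mul1r ?mul0r ?s_unitr // (linear0_of (bs.1 _)).
have sbE (b : bool) x : sb ((b%:R : H) ⊗ x) = b%:R * eps x.
  by case: b; rewrite ?mul1r ?mul0r ?sb_unitl // (linear0_of (bsb.2 _)).
under eq_bigr do under eq_bigr do under eq_bigr do
  rewrite sE sbE !cT.2 -mulrA.
under eq_bigr do under eq_bigr do rewrite sum_mul_deltal.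
under eq_bigr do rewrite -mulr_sumr sum_mul_deltal.
exact: sum_mul_deltal.
Qed.

(** A left inverse of the identity for the convolution product of maps from
    the co-opposite coalgebra of [H] to the twisted algebra.  The product
    produces [s(c1, S c4)] times [c2 S(c3)], and the functional that is left
    over is cancelled by [sum_s_sb]. *)
Lemma cleft_inverseP c :
  \sw_(c1, c2 <- Delta c) twisted_mul (cleft_inverse c2) c1 = (eps c : k) *: (1 : H).
Proof.
have cT := @comatrix_coef k H.
have bm := twisted_mul_bilinear; have Lc := cleft_inverse_linear.
move: c; apply: linear_coef_ext; try lin.
move=> i j; rewrite sw_comatrix //; last by lin.
pose g i j := \sum_l (sb (S (T i l) ⊗ T l j) : k).
have cE a : cleft_inverse (T a j) = \sum_m g m j *: S (T a m).
  rewrite /cleft_inverse sw_comatrix //; last by lin.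
  apply: eq_bigr => m _; rewrite sw_comatrix //; last by lin.
  by rewrite scaler_suml.
have mE m : \sum_a twisted_mul (S (T a m)) (T i a) =
    (\sum_l (s (T i l ⊗ S (T l m)) : k)) *: 1.
  under eq_bigr do rewrite (twisted_mul_comatrix _ _ _ _ comatrix_S cT).
  rewrite exchange_big scaler_suml; apply: eq_bigr => l _ /=.
  rewrite exchange_big /=.
  under eq_bigr do rewrite -scaler_sumr Sr.
  rewrite (bigD1 l) //= eqxx big1 ?addr0 // => b /negPf->.
  by rewrite scaler0.
transitivity (\sum_m g m j *: \sum_a twisted_mul (S (T a m)) (T i a)).
  under [RHS]eq_bigr do rewrite scaler_sumr.
  rewrite [RHS]exchange_big; apply: eq_bigr => a _ /=.
  rewrite cE (linear_sum_of (bm.2 _)); apply: eq_bigr => m _.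
  exact: (linear_scale_of (bm.2 _)).
under eq_bigr do rewrite mE scalerA mulrC.
by rewrite -scaler_suml sum_s_sb cT.2.
Qed.

End Cleaving.

(** * Sandwich maps *)

Section Sandwich.
Variables (k : fieldType) (H : hopfType k).

Local Notation T := (@coef k H).

Variables (mu : H -> H -> H) (J J' : H -> H) (beta : H -> H -> k^o).
Hypothesis mu_bilinear : is_bilinear mu.
Hypothesis muA : associative mu.
Hypothesis mu1 : right_id 1 mu.
Hypotheses (J_linear : linear J) (J'_linear : linear J').
Hypothesis muJ : forall c,
  \sw_(c1, c2 <- Delta c) mu (J c2) c1 = (eps c : k) *: (1 : H).
Hypothesis muJ' : forall c,
  \sw_(c1, c2 <- Delta c) mu c1 (J' c2) = (eps c : k) *: (1 : H).
Hypothesis beta_bilinear : is_bilinear beta.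

Let Psi : 'End(tensor H H) := linfun (fun t : tensor H H =>
  \sw_(a, b <- t) \sw_(b1, b2 <- Delta b) (mu a b2 ⊗ b1)).

Let Mid : 'Hom(tensor H H, 'End(H)) := linfun (fun t : tensor H H =>
  \sw_(a, b <- t) linfun (fun c : H => (beta b c : k) *: a)).

Let Phi : 'End('End(H)) := linfun (fun f : 'End(H) =>
  linfun (fun c : H => \sw_(c1, c2 <- Delta c) mu (f c1) c2)).

Let PsiE a b : Psi (a ⊗ b) = \sw_(b1, b2 <- Delta b) (mu a b2 ⊗ b1).
Proof. by rewrite linfunE; [rewrite tliftE //; lin | lin]. Qed.

Let MidE a b c : Mid (a ⊗ b) c = (beta b c : k) *: a.
Proof.
by rewrite linfunE; [rewrite tliftE; [rewrite linfunE //; lin | lin] | lin].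
Qed.

Let PhiE f c : Phi f c = \sw_(c1, c2 <- Delta c) mu (f c1) c2.
Proof. by rewrite linfunE; [rewrite linfunE //; lin | lin]. Qed.

Let Psi_bij : bijective Psi.
Proof.
have cT := @comatrix_coef k H.
pose Psi' (t : tensor H H) : tensor H H :=
  \sw_(a, b <- t) \sw_(b1, b2 <- Delta b) (mu a (J b2) ⊗ b1).
apply: surj_lfun_bij => // t; exists (Psi' t); move: t.
apply: tensor_ext; rewrite /Psi'; try lin.
move=> a; apply: linear_coef_ext; try lin.
move=> i j; rewrite tliftE; last by lin.
rewrite sw_comatrix //; last by lin.
rewrite linear_sum /=.
under eq_bigr => l _ do (rewrite PsiE sw_comatrix //; last by lin).
rewrite exchange_big /=.
transitivity (\sum_l ((l == j)%:R : k) *: (a ⊗ T i l)); last exact: sum_deltar.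
apply: eq_bigr => l _.
rewrite -(linear_sum_of (f := fun t : H => t ⊗ T i l)); last by lin.
under eq_bigr do rewrite -muA.
rewrite -(linear_sum_of (mu_bilinear.1 _)).
have := muJ (T l j); rewrite sw_comatrix //; last by lin.
move=> ->; rewrite cT.2 (linear_scale_of (mu_bilinear.1 _)) mu1.
by rewrite (linear_scale_of (f := fun t : H => t ⊗ T i l)) //; lin.
Qed.

Let Phi_inj : injective Phi.
Proof.
have cT := @comatrix_coef k H.
pose Phi' (f : 'End(H)) (c : H) := \sw_(c1, c2 <- Delta c) mu (f c1) (J' c2).
have Phi'K f c : Phi' (Phi f) c = f c.
  move: c; apply: linear_coef_ext; rewrite /Phi'; try lin.
  move=> i j; rewrite sw_comatrix //; last by lin.
  under eq_bigr => l _.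
    rewrite PhiE sw_comatrix //; last by lin.
    rewrite (linear_sum_of (mu_bilinear.2 _)).
    under eq_bigr do rewrite -muA.
    over.
  rewrite exchange_big /=.
  transitivity (\sum_l ((l == j)%:R : k) *: f (T i l)); last exact: sum_deltar.
  apply: eq_bigr => l _; rewrite -(linear_sum_of (mu_bilinear.1 _)).
  have := muJ' (T l j); rewrite sw_comatrix //; last by lin.
  by move=> ->; rewrite cT.2 (linear_scale_of (mu_bilinear.1 _)) mu1.
by move=> f g fg; apply/lfunP=> c; rewrite -[LHS]Phi'K fg Phi'K.
Qed.

Let Mid_inj : (forall b, (forall c, beta b c = 0) -> b = 0) -> injective Mid.
Proof.
move=> beta0; apply/lker0P; rewrite -subv0; apply/subvP=> t.
rewrite memv_ker memv0 => /eqP Mt0; apply/eqP; rewrite [t]tensor_expand.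
pose ti i : H := r2v (row i t).
suff ti0 i : ti i = 0.
  by apply: big1 => i _; rewrite -/(ti i) ti0 (linear0_of (f := pure _)) //; lin.
apply: beta0 => c; have := congr1 (fun f : 'End(H) => f c) Mt0.
rewrite [t in Mid t]tensor_expand linear_sum /= sum_lfunE zero_lfunE.
under eq_bigr do rewrite MidE -/(ti _).
move/(congr1 v2r); rewrite linear_sum linear0 => /rowP/(_ i).
rewrite summxE mxE => <-; rewrite (bigD1 i) //= big1 ?addr0.
  by rewrite linearZ /= r2vK !mxE !eqxx mulr1.
by move=> l li; rewrite linearZ /= r2vK !mxE eqxx eq_sym (negPf li) mulr0.
Qed.

(** [K] is the composite of [Psi], [Mid] and [Phi].  The maps [J] and [J'] give
    a right inverse of [Psi] and a left inverse of [Phi], and [Mid] is injective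
    exactly when [beta] is nondegenerate in its first argument. *)
Lemma sandwich_bijP (K : 'Hom(tensor H H, 'End(H))) :
  (forall a b c, K (a ⊗ b) c =
     \sw_(c1, c2 <- Delta c) \sw_(b1, b2 <- Delta b)
       ((beta b1 c1 : k) *: mu (mu a b2) c2)) ->
  bijective K <-> (forall b, (forall c, beta b c = 0) -> b = 0).
Proof.
move=> Kab.
have KE t : K t = Phi (Mid (Psi t)).
  move: t; apply: tensor_ext; try lin; move=> a b; apply/lfunP=> c.
  rewrite Kab PhiE; apply: eq_sw => c1 c2.
  rewrite PsiE (linear_sw_of (L := Mid)); last by lin.
  rewrite (linear_sw_of (L := fun f : 'End(H) => mu (f c1) c2)); last by lin.
  by apply: eq_sw => b1 b2; rewrite MidE (linear_scale_of (mu_bilinear.2 _)).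
split=> [/bij_inj K_inj b beta0|/Mid_inj M_inj].
  have [Psi' _ PsiK] := Psi_bij.
  suff : 1 ⊗ b = 0 :> tensor H H.
    move/(congr1 (tlift (fun x y : H => (eps x : k) *: y))).
    rewrite (linear0_of (tlift_is_linear _)) tliftE; last by lin.
    by rewrite eps1_subproof scale1r.
  rewrite -[LHS]PsiK -[RHS]PsiK; congr (Psi _); apply: K_inj.
  rewrite !KE !PsiK; congr (Phi _); apply/lfunP=> c.
  by rewrite linear0 MidE beta0 scale0r zero_lfunE.
apply: inj_lfun_bij => // s t; rewrite !KE => /Phi_inj/M_inj.
exact: bij_inj Psi_bij _ _.
Qed.

End Sandwich.

(** * The opposite Hopf algebra *)

(** The opposite product has the antipode [S^-1] and the cocycle [sigma tau];
    its twisted product is the opposite of the one of [H], so that a left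
    convolution inverse for it is a right one for [H]. *)
Section Opposite.
Variables (k : fieldType) (H : hopfType k).
Implicit Types (I J : finType) (f g sigma : dual (tensor H H)).

Local Notation S := (@antipode k H).
Local Notation T := (@coef k H).

Definition opp_mul (x y : H) : H := y * x.

Lemma comatrix_opp_mul I J (X : I -> I -> H) (Y : J -> J -> H) :
  comatrix X -> comatrix Y ->
  comatrix (fun u v : I * J => opp_mul (X u.1 v.1) (Y u.2 v.2)).
Proof.
move=> cX cY; split=> u v; rewrite /opp_mul.
  2: by rewrite epsM_subproof cX.2 cY.2 -natrM mulnb andbC -xpair_eqE
        -!surjective_pairing.
rewrite DeltaM_subproof sw_exchange.
by rewrite sw2_comatrix //; [rewrite pair_bigA | lin | lin].
Qed.

Definition flip_form f : dual (tensor H H) := (f \o flip H H)%VF.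

Lemma flip_form_pure f x y : flip_form f (x ⊗ y) = f (y ⊗ x).
Proof. by rewrite comp_lfunE flip_pure. Qed.

Lemma conv_flip_form f g : conv (flip_form f) (flip_form g) = flip_form (conv f g).
Proof.
apply/lfunP; apply: tensor_ext; try lin.
move=> x y; rewrite flip_form_pure !conv_pure sw_exchange.
by do 2!apply: eq_sw => ? ?; rewrite !flip_form_pure.
Qed.

Lemma flip_form_conv1 : flip_form (@conv1 k H) = @conv1 k H.
Proof.
apply/lfunP; apply: tensor_ext; try lin.
by move=> x y; rewrite flip_form_pure !conv1_pure mulrC.
Qed.

Lemma flip_form_cocycle sigma :
  (forall h l m : H,
    \sw_(l1, l2 <- Delta l) \sw_(m1, m2 <- Delta m)
      (sigma (l1 ⊗ m1) * sigma (h ⊗ (l2 * m2)) : k^o) =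
    \sw_(h1, h2 <- Delta h) \sw_(l1, l2 <- Delta l)
      (sigma (h1 ⊗ l1) * sigma ((h2 * l2) ⊗ m) : k^o)) ->
  forall h l m : H,
    \sw_(l1, l2 <- Delta l) \sw_(m1, m2 <- Delta m)
      (flip_form sigma (l1 ⊗ m1) * flip_form sigma (h ⊗ opp_mul l2 m2) : k^o) =
    \sw_(h1, h2 <- Delta h) \sw_(l1, l2 <- Delta l)
      (flip_form sigma (h1 ⊗ l1) * flip_form sigma (opp_mul h2 l2 ⊗ m) : k^o).
Proof.
move=> cocycle h l m; rewrite sw_exchange [RHS]sw_exchange.
transitivity (\sw_(m1, m2 <- Delta m) \sw_(l1, l2 <- Delta l)
    (sigma (m1 ⊗ l1) * sigma ((m2 * l2) ⊗ h) : k^o)).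
  by do 2!apply: eq_sw => ? ?; rewrite !flip_form_pure.
by rewrite -cocycle; do 2!apply: eq_sw => ? ?; rewrite !flip_form_pure.
Qed.

Lemma twisted_mul_opp sigma a b :
  twisted_mul opp_mul (flip_form sigma) a b = twisted_mul *%R sigma b a.
Proof.
rewrite /twisted_mul sw_exchange.
by do 2!apply: eq_sw => ? ?; rewrite flip_form_pure.
Qed.

Variable Sb : 'End(H).
Hypotheses (SbK : cancel Sb S) (SK : cancel S Sb).

Lemma Delta_antipode_inv x :
  Delta (Sb x) = \sw_(x1, x2 <- Delta x) (Sb x2 ⊗ Sb x1).
Proof.
rewrite -{2}[x]SbK Delta_antipode (linear_sw_of _ _ (tlift_is_linear _)).
transitivity (\sw_(y1, y2 <- Delta (Sb x)) (y1 ⊗ y2)).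
  move: (Delta _); apply: tensor_ext; try lin.
  by move=> u v; rewrite tliftE //; lin.
by apply: eq_sw => u v; rewrite tliftE ?SK //; lin.
Qed.

Lemma comatrix_antipode_inv I (X : I -> I -> H) :
  comatrix X -> comatrix (fun i j => Sb (X j i)).
Proof.
move=> cX; split=> i j; last by rewrite -eps_antipode SbK cX.2 eq_sym.
by rewrite Delta_antipode_inv sw_comatrix //; lin.
Qed.

Lemma antipode_invl I (X : I -> I -> H) i j : comatrix X ->
  \sum_l opp_mul (Sb (X i l)) (X l j) = (i == j)%:R.
Proof.
move=> cX; apply: (can_inj SK); rewrite linear_sum raddfMn /= antipode1.
under eq_bigr do rewrite antipodeM SbK.
exact: antipoder_comatrix.
Qed.

Lemma antipode_invr I (X : I -> I -> H) i j : comatrix X ->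
  \sum_l opp_mul (X i l) (Sb (X l j)) = (i == j)%:R.
Proof.
move=> cX; apply: (can_inj SK); rewrite linear_sum raddfMn /= antipode1.
under eq_bigr do rewrite antipodeM SbK.
exact: antipodel_comatrix.
Qed.

End Opposite.

(** * The twisted comodule algebra *)

Section TwistedAlgebra.
Variables (k : fieldType) (H : hopfType k).
Variables (r sigma sigmainv : dual (tensor H H)).
Hypothesis r_rform : universal_rform r.
Hypothesis sigma_cocycle : two_cocycle sigma.
Hypothesis sigma_inverse : conv_inverse sigma sigmainv.

Local Notation S := (@antipode k H).
Local Notation T := (@coef k H).
Local Notation m := (twisted_mul *%R sigma).
Local Notation r_sigma := (twisted_rform r sigma sigmainv).

Let cT : comatrix T := @comatrix_coef k H.
Let bm : is_bilinear m.
Proof. exact: twisted_mul_bilinear. Qed.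

Let m_prod (I J : finType) (X : I -> I -> H) (Y : J -> J -> H) i j p q :
  comatrix X -> comatrix Y ->
  m (X i j) (Y p q) =
  \sum_l \sum_n ((sigma (Y p n ⊗ X i l) : k) *: (Y n q * X l j)).
Proof. by move=> cX cY; apply: twisted_mul_comatrix => //; lin. Qed.

Lemma twisted_mulA : associative m.
Proof.
have [_ _ _ cocycle] := sigma_cocycle.
suff mA i j p q a b :
    m (T i j) (m (T p q) (T a b)) = m (m (T i j) (T p q)) (T a b).
  move=> x y z; move: x.
  apply: (linear_coef_ext (f := fun x => m x (m y z)) (g := fun x => m (m x y) z)).
  1, 2: by lin.
  move=> i j; move: y z; apply: bilinear_coef_ext; [lin | lin | ].
  by move=> p q a b; exact: mA.
have cTT := comatrix_mul cT cT.
pose s x y : k := sigma (x ⊗ y).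
(* The two members of the cocycle identity are the coefficients of the two
   products; [x] is the column index of the family [T * T]. *)
transitivity (\sum_l \sum_(x : 'I_(dim H) * 'I_(dim H))
    (\sum_c \sum_n s (T a c) (T p n) * s (T c x.1 * T n x.2) (T i l)) *:
    (T x.1 b * T x.2 q * T l j)).
  rewrite [m (T p q) _]m_prod // (linear_sum_of (bm.1 _)).
  under eq_bigr => n _.
    rewrite (linear_sum_of (bm.1 _)).
    under eq_bigr => c _.
      rewrite (linear_scale_of (bm.1 _)).
      rewrite (m_prod (Y := fun u v => T u.1 v.1 * T u.2 v.2)
                 i j (c, n) (b, q) cT cTT).
      rewrite scaler_sumr.
      under eq_bigr do rewrite scaler_sumr.
      over.
    rewrite exchange_big /=.
    under eq_bigr do rewrite exchange_big /=.
    over.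
  rewrite exchange_big; apply: eq_bigr => l _ /=.
  rewrite exchange_big; apply: eq_bigr => x _ /=.
  rewrite exchange_big scaler_suml; apply: eq_bigr => c _ /=.
  by rewrite scaler_suml; apply: eq_bigr => n _; rewrite scalerA.
transitivity (\sum_l \sum_(x : 'I_(dim H) * 'I_(dim H))
    (\sum_n \sum_c s (T p n) (T i c) * s (T a l) (T n x.1 * T c x.2)) *:
    (T l b * (T x.1 q * T x.2 j))); last first.
  rewrite [m (T i j) _]m_prod // (linear_sum_of (bm.2 _)).
  under [RHS]eq_bigr => c _.
    rewrite (linear_sum_of (bm.2 _)).
    under eq_bigr => n _.
      rewrite (linear_scale_of (bm.2 _)).
      rewrite (m_prod (X := fun u v => T u.1 v.1 * T u.2 v.2)
                 (n, c) (q, j) a b cTT cT).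
      rewrite scaler_sumr.
      under eq_bigr do rewrite scaler_sumr.
      rewrite exchange_big /=.
      over.
    rewrite exchange_big /=.
    under eq_bigr do rewrite exchange_big /=.
    over.
  rewrite [RHS]exchange_big; apply: eq_bigr => l _ /=.
  rewrite [RHS]exchange_big; apply: eq_bigr => x _ /=.
  rewrite exchange_big scaler_suml; apply: eq_bigr => c _ /=.
  by rewrite scaler_suml; apply: eq_bigr => n _; rewrite scalerA.
under eq_bigr => l _ do rewrite -(pair_bigA _ (fun y z =>
   (\sum_c \sum_n s (T a c) (T p n) * s (T c y * T n z) (T i l)) *:
    (T y b * T z q * T l j))) /=.
under [RHS]eq_bigr => l _ do rewrite -(pair_bigA _ (fun y z =>
   (\sum_n \sum_c s (T p n) (T i c) * s (T a l) (T n y * T c z)) *: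
    (T l b * (T y q * T z j)))) /=.
rewrite exchange_big; apply: eq_bigr => y _ /=.
rewrite exchange_big; apply: eq_bigr => z _ /=.
apply: eq_bigr => l _; rewrite mulrA; congr (_ *: _).
apply/esym; apply: (cocycle_comatrix (mu := *%R)) => //; lin.
Qed.

Lemma twisted_mul1 : left_id 1 m /\ right_id 1 m.
Proof.
have [_ s1r s1l _] := sigma_cocycle.
split=> x; rewrite /twisted_mul Delta1_subproof.
  rewrite tliftE; last by lin.
  rewrite -[RHS]counitl_subproof; apply: eq_sw => x1 x2.
  by rewrite s1r mulr1.
rewrite -[RHS]counitl_subproof; apply: eq_sw => x1 x2.
rewrite tliftE; last by lin.
by rewrite s1l mul1r.
Qed.

Lemma Delta_twisted_mul a b :
  Delta (m a b) = \sw_(a0, a1 <- Delta a) \sw_(b0, b1 <- Delta b)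
    (m a0 b0 ⊗ (b1 * a1)).
Proof.
move: a b; apply: bilinear_coef_ext; try lin.
move=> i j p q; have cTT := comatrix_mul cT cT.
have pl w : linear (fun t : H => t ⊗ w : tensor H H) by lin.
transitivity (\sum_c \sum_d \sum_n \sum_l (sigma (T p d ⊗ T i c) : k) *:
    (((T d n * T c l) ⊗ (T n q * T l j)) : tensor H H)).
  rewrite m_prod // linear_sum; apply: eq_bigr => c _ /=.
  rewrite linear_sum; apply: eq_bigr => d _ /=.
  rewrite linearZ /= (cTT.1 (d, c) (q, j)) -(pair_bigA _ (fun n l =>
    (T d n * T c l) ⊗ (T n q * T l j))) scaler_sumr.
  by apply: eq_bigr => n _; rewrite scaler_sumr.
rewrite sw2_comatrix //; [ | lin | lin].
under [RHS]eq_bigr => l _.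
  under eq_bigr => n _.
    rewrite m_prod // (linear_sum_of (pl _)).
    under eq_bigr => c _.
      rewrite (linear_sum_of (pl _)).
      under eq_bigr do rewrite (linear_scale_of (pl _)).
      over.
    over.
  rewrite exchange_big /=.
  under eq_bigr do rewrite exchange_big /=.
  over.
rewrite [RHS]exchange_big; apply: eq_bigr => c _ /=.
rewrite [RHS]exchange_big; apply: eq_bigr => d _ /=.
by rewrite exchange_big.
Qed.

Lemma opcomodule_twisted_alg : opcomodule_algebra (twisted_alg sigma).
Proof.
have [m1l m1r] := twisted_mul1.
split; first by split; [exact: bm | exact: twisted_mulA | exact: m1l | exact: m1r].
- by split=> a; [exact: coassoc_subproof | exact: counitr_subproof].
- exact: Delta1_subproof.
- exact: Delta_twisted_mul.
Qed.

(** Over the families [T], [m] is the matrix of [sigma tau] times the matrix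
    of the opposite product, and also the matrix of [sigma] times that of the
    product, with the two arguments exchanged; [r] intertwines the two
    products. *)
Lemma twisted_mul_rform x y :
  \sw_(x1, x2 <- Delta x) \sw_(y1, y2 <- Delta y)
    ((r (x2 ⊗ y2) : k) *: m x1 y1) =
  \sw_(x1, x2 <- Delta x) \sw_(y1, y2 <- Delta y)
    ((r_sigma (x1 ⊗ y1) : k) *: m y2 x2).
Proof.
move: x y; apply: bilinear_coef_ext; try lin.
move=> i j p q; have [_ _ _ rC] := r_rform.
pose I : finType := ('I_(dim H) * 'I_(dim H))%type.
pose V (f : dual (tensor H H)) : 'M[H]_#|I| :=
  family_mx (fun u v : I => (f (T u.1 v.1 ⊗ T u.2 v.2) : k)%:A).
pose M := family_mx (fun u v : I => T u.1 v.1 * T u.2 v.2).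
pose Mop := family_mx (fun u v : I => T u.2 v.2 * T u.1 v.1).
pose N := family_mx (fun u v : I => m (T u.1 v.1) (T u.2 v.2)).
pose Nop := family_mx (fun u v : I => m (T u.2 v.2) (T u.1 v.1)).
have VE f : V f = map_mx (in_alg H) (form_mx f T T).
  by apply/matrixP=> a b; rewrite !mxE.
have VM f g : V (conv f g) = V f *m V g.
  by rewrite !VE form_mx_conv // map_mxM.
have MopV : Mop *m V r = V r *m M.
  rewrite !family_mxM; apply/family_mx_eq => -[i1 p1] [j1 q1] /=.
  under eq_bigr do rewrite mulr_algr.
  under [RHS]eq_bigr do rewrite mulr_algl.
  rewrite -(pair_bigA _ (fun l n =>
    (r (T l j1 ⊗ T n q1) : k) *: (T p1 n * T i1 l))).
  rewrite -(pair_bigA _ (fun l n =>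
    (r (T i1 l ⊗ T p1 n) : k) *: (T l j1 * T n q1))) /=.
  have := rC (T i1 j1) (T p1 q1).
  by do 2![rewrite (sw2_comatrix cT cT); [ | lin | lin]].
have NE : N = V (flip_form sigma) *m Mop.
  rewrite family_mxM; apply/family_mx_eq => -[i1 p1] [j1 q1] /=.
  under [RHS]eq_bigr do rewrite mulr_algl flip_form_pure.
  by rewrite m_prod // pair_bigA.
have NopE : Nop = V sigma *m M.
  rewrite family_mxM; apply/family_mx_eq => -[i1 p1] [j1 q1] /=.
  under [RHS]eq_bigr do rewrite mulr_algl.
  by rewrite m_prod // exchange_big pair_bigA.
have NV : N *m V r = V r_sigma *m Nop.
  rewrite NE NopE -mulmxA MopV !VM !mulmxA; congr (_ *m _).
  rewrite -[in RHS]mulmxA -(VM sigmainv) sigma_inverse.2.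
  by rewrite [V (conv1 H)]VE form_mx_conv1 // map_mx1 mulmx1.
move: NV; rewrite !family_mxM => /family_mx_eq /(_ (i, p) (j, q)) /=.
under eq_bigr do rewrite mulr_algr.
under [RHS]eq_bigr do rewrite mulr_algl.
rewrite -(pair_bigA _ (fun l n =>
    (r (T l j ⊗ T n q) : k) *: m (T i l) (T p n))).
rewrite -(pair_bigA _ (fun l n =>
    (r_sigma (T i l ⊗ T p n) : k) *: m (T n q) (T l j))) /= => NV.
by do 2![rewrite (sw2_comatrix cT cT); [ | lin | lin]].
Qed.

Local Notation A := (twisted_alg sigma).

Lemma azumayaF_pure a b c :
  azumayaF r A (a ⊗ b) c = \sw_(c1, c2 <- Delta c) \sw_(b1, b2 <- Delta b)
    ((r_sigma (c1 ⊗ b1) : k) *: m (m a b2) c2).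
Proof.
have -> : azumayaF r A (a ⊗ b) c = \sw_(c1, c2 <- Delta c)
    \sw_(b1, b2 <- Delta b) ((r (c2 ⊗ b2) : k) *: m (m a c1) b1).
  rewrite linfunE; last by lin.
  rewrite tliftE; last by lin.
  by rewrite linfunE //; lin.
transitivity (m a (\sw_(c1, c2 <- Delta c) \sw_(b1, b2 <- Delta b)
    ((r (c2 ⊗ b2) : k) *: m c1 b1))).
  rewrite (linear_sw_of _ _ (bm.1 a)); apply: eq_sw => c1 c2.
  rewrite (linear_sw_of _ _ (bm.1 a)); apply: eq_sw => b1 b2.
  by rewrite (linear_scale_of (bm.1 a)) twisted_mulA.
rewrite twisted_mul_rform.
rewrite (linear_sw_of _ _ (bm.1 a)); apply: eq_sw => c1 c2.
rewrite (linear_sw_of _ _ (bm.1 a)); apply: eq_sw => b1 b2.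
by rewrite (linear_scale_of (bm.1 a)) twisted_mulA.
Qed.

Lemma azumayaG_pure a b c :
  azumayaG r A (a ⊗ b) c = \sw_(c1, c2 <- Delta c) \sw_(a1, a2 <- Delta a)
    ((r_sigma (a1 ⊗ c1) : k) *: m c2 (m a2 b)).
Proof.
have -> : azumayaG r A (a ⊗ b) c = \sw_(a1, a2 <- Delta a)
    \sw_(c1, c2 <- Delta c) ((r (a2 ⊗ c2) : k) *: m (m a1 c1) b).
  rewrite linfunE; last by lin.
  rewrite tliftE; last by lin.
  by rewrite linfunE //; lin.
transitivity (m (\sw_(a1, a2 <- Delta a) \sw_(c1, c2 <- Delta c)
    ((r (a2 ⊗ c2) : k) *: m a1 c1)) b).
  rewrite (linear_sw_of _ _ (bm.2 b)); apply: eq_sw => a1 a2.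
  rewrite (linear_sw_of _ _ (bm.2 b)); apply: eq_sw => c1 c2.
  by rewrite (linear_scale_of (bm.2 b)).
rewrite twisted_mul_rform sw_exchange.
rewrite (linear_sw_of _ _ (bm.2 b)); apply: eq_sw => a1 a2.
rewrite (linear_sw_of _ _ (bm.2 b)); apply: eq_sw => c1 c2.
by rewrite (linear_scale_of (bm.2 b)) twisted_mulA.
Qed.

End TwistedAlgebra.

(** * The main equivalence *)

Lemma theta_pure (k : fieldType) (H : hopfType k)
    (r sigma sigmainv : dual (tensor H H)) (h x : H) :
  theta r sigma sigmainv h x = twisted_rform r sigma sigmainv (x ⊗ h).
Proof. by rewrite linfunE; [rewrite linfunE //; lin | lin]. Qed.

Theorem theorem2p1 (k : fieldType) (H : hopfType k)
    (r : dual (tensor H H)) (r_rform : universal_rform r)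
    (sigma sigmainv : dual (tensor H H)) (sigma_cocycle : two_cocycle sigma)
    (sigma_inverse : conv_inverse sigma sigmainv) :
  azumaya r (twisted_alg sigma) <-> bijective (theta r sigma sigmainv).
Proof.
pose m : H -> H -> H := twisted_mul *%R sigma.
pose mop x y := m y x.
pose rs := twisted_rform r sigma sigmainv.
pose th := theta r sigma sigmainv.
have [_ s_unitr s_unitl cocycle] := sigma_cocycle.
have cT := @comatrix_coef k H.
have bm : is_bilinear m by exact: twisted_mul_bilinear.
have bmop : is_bilinear mop by split=> ?; [exact: bm.2 | exact: bm.1].
have mA : associative m := twisted_mulA sigma_cocycle.
have [m1l m1r] := twisted_mul1 sigma_cocycle.
have [Sb0 SK0 SbK0] := antipode_bij r_rform.
pose Sb : 'End(H) := (@antipode k H)^-1%VF.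
have SK : cancel (@antipode k H) Sb.
  by apply: lker0_lfunK; apply/lker0P; exact: can_inj SK0.
have SbK : cancel Sb (@antipode k H).
  by move=> x; rewrite -[x]SbK0 SK.
pose J : H -> H := cleft_inverse (@antipode k H) sigmainv.
pose J' : H -> H := cleft_inverse Sb (flip_form sigmainv).
have LJ : linear J by exact: cleft_inverse_linear.
have LJ' : linear J' by exact: cleft_inverse_linear.
have mJ c : \sw_(c1, c2 <- Delta c) m (J c2) c1 = (eps c : k) *: (1 : H).
  apply: cleft_inverseP => //; try lin.
  - by move=> I I' X Y; exact: comatrix_mul.
  - exact: comatrix_antipode.
  - by move=> i j; exact: antipodel_comatrix.
  - by move=> i j; exact: antipoder_comatrix.
have mJ' c : \sw_(c1, c2 <- Delta c) m c1 (J' c2) = (eps c : k) *: (1 : H).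
  transitivity (\sw_(c1, c2 <- Delta c)
      twisted_mul (@opp_mul k H) (flip_form sigma) (J' c2) c1).
    by apply: eq_sw => c1 c2; rewrite twisted_mul_opp.
  apply: cleft_inverseP.
  - by rewrite /opp_mul; lin.
  - by move=> I I' X Y; exact: comatrix_opp_mul.
  - lin.
  - exact: comatrix_antipode_inv.
  - by move=> i j; exact: antipode_invl.
  - by move=> i j; exact: antipode_invr.
  - by case: sigma_inverse => ssb sbs; split;
      rewrite conv_flip_form ?ssb ?sbs flip_form_conv1.
  - by move=> h; rewrite flip_form_pure.
  - by move=> h; rewrite flip_form_pure.
  - exact: flip_form_cocycle.
have FP : bijective (azumayaF r (twisted_alg sigma)) <->
    (forall b, (forall c, rs (c ⊗ b) = 0) -> b = 0).
  apply: (sandwich_bijP (mu := m) (J := J) (J' := J')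
            (beta := fun y c => rs (c ⊗ y))) => //; try lin.
  exact: azumayaF_pure.
have GP : bijective (azumayaG r (twisted_alg sigma) \o flip H H)%VF <->
    (forall b, (forall c, rs (b ⊗ c) = 0) -> b = 0).
  apply: (sandwich_bijP (mu := mop) (J := J') (J' := J)
            (beta := fun y c => rs (y ⊗ c))) => //; try lin.
  - by move=> x y z; rewrite /mop mA.
  - by move=> a b c; rewrite comp_lfunE flip_pure
      (azumayaG_pure r_rform sigma_cocycle sigma_inverse).
have thP : bijective th <-> (forall b, (forall c, rs (c ⊗ b) = 0) -> b = 0).
  split=> [/bij_inj th_inj b rs0|rs0].
    apply: th_inj; apply/lfunP=> c.
    by rewrite theta_pure linear0 zero_lfunE; exact: rs0.
  apply: inj_lfun_bij; first by rewrite -[RHS]/(dim H * 1)%N muln1.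
  apply/lker0P; rewrite -subv0; apply/subvP=> b.
  rewrite memv_ker memv0 => /eqP thb; apply/eqP; apply: rs0 => c.
  by rewrite -theta_pure -/th thb zero_lfunE.
split=> [[_ Fbij _]|th_bij]; first exact/thP/FP.
split; first exact: opcomodule_twisted_alg.
  exact/FP/thP.
have flipK : cancel (flip H H) (flip H H).
  by apply: tensor_ext; try lin; move=> u v; rewrite !flip_pure.
(* Every coordinate functional is some [theta c], so an element annihilated by
   all [r_sigma(-, c)] has zero coordinates. *)
have : bijective (azumayaG r (twisted_alg sigma) \o flip H H)%VF.
  apply/GP => b rs0; have [th' _ thK] := th_bij.
  apply: (can_inj v2rK); rewrite linear0; apply/rowP=> i; rewrite mxE.
  pose phi : dual H := linfun (fun x : H => v2r x 0 i : k^o).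
  have phiE x : phi x = v2r x 0 i.
    by rewrite linfunE // => a u v; rewrite linearP !mxE.
  by rewrite -phiE -[phi]thK theta_pure; exact: rs0.
case=> K GK KG; exists (flip H H \o K) => t /=.
  by have := GK (flip H H t); rewrite comp_lfunE flipK => ->; exact: flipK.
by have := KG t; rewrite comp_lfunE.
Qed.
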